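(* Let $k$ be a field of characteristic zero and let $H:\ 1, h_1=r, h_2, \dots, h_e, h_{e+1}=0$ be an $O$-sequence (the Hilbert function of some standard graded artinian $k$-algebra in $r$ variables). Let $t$ be the smallest integer such that $h_t \le t$. Then all standard graded artinian $k$-algebras $A=k[x_1,\dots,x_r]/I$ having Hilbert function $H$ enjoy the Maximal Rank Property if and only if either (i) $r=2$; or (ii) $r>2$, $h_t\le 2$, and for all indices $i=1,2,\dots,t-1$ we have $h_{i-1}=((h_i)_{(i)})^{-1}_{-1}$.
   Context: $R=k[x_1,\dots,x_r]$ is the standard graded polynomial ring ($\deg x_i=1$) over a field $k$ of characteristic zero; a standard graded algebra is $A=R/I$ with $I$ a homogeneous ideal, and its Hilbert function is $H(A,d)=\dim_k A_d$; $A$ is artinian if its Hilbert function is eventually $0$. An $O$-sequence is a sequence that occurs as the Hilbert function of a standard graded $k$-algebra (characterized by Macaulay's theorem). A property holds for a ''general'' form if it holds for all forms whose coefficients lie in a nonempty Zariski-open subset of the relevant space of forms. $A$ has the Maximal Rank Property (MRP) if for every $d\ge 1$ and a general form $F$ of degree $d$, the multiplication map $\times F: A_i\to A_{i+d}$ has maximal rank (is injective or surjective) for all $i\ge 0$. Notation: for positive integers $n,d$, the $d$-binomial expansion of $n$ is the unique expression $n=\binom{n_d}{d}+\binom{n_{d-1}}{d-1}+\cdots+\binom{n_j}{j}$ with $n_d>n_{d-1}>\dots>n_j\ge j\ge 1$; then $(n_{(d)})^{-1}_{-1}=\binom{n_d-1}{d-1}+\binom{n_{d-1}-1}{d-2}+\cdots+\binom{n_j-1}{j-1}$,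 with the convention $\binom{m}{n}=0$ if $m<n$ or $n<0$.
   Formalization: The formal theorem assumes r ≥ 2; for r = 1 the statement as written is false, since k[x]/(x^{e+1}) is the only algebra with its Hilbert function and has the Maximal Rank Property, while neither (i) nor (ii) holds (r = 0 fails likewise). *)

(* Defs.v *)
From HB Require Import structures.
From mathcomp Require Import all_boot all_order all_algebra.
From mathcomp Require Import mpoly.
Set Implicit Arguments. Unset Strict Implicit. Unset Printing Implicit Defensive.
Import Order.TTheory GRing.Theory.
Local Open Scope ring_scope.

Section Defs.
Variables (k : fieldType) (r : nat).
Local Notation R := {mpoly k[r]}.

Definition hcomp (d : nat) (p : R) : R :=
  \sum_(m <- msupp p | mdeg m == d) p@_m *: 'X_[m].

Definition homog_ideal (I : R -> Prop) : Prop :=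
  [/\ I 0,
      (forall p q, I p -> I q -> I (p + q)),
      (forall p q, I q -> I (p * q)) &
      (forall d p, I p -> I (hcomp d p))].

Definition indep_mod (I : R -> Prop) (s : seq R) : Prop :=
  forall c : 'I_(size s) -> k,
    I (\sum_(i < size s) c i *: s`_i) -> forall i, c i = 0.

Definition spans_mod (I : R -> Prop) (d : nat) (s : seq R) : Prop :=
  forall p : R, p \is d.-homog ->
    exists c : 'I_(size s) -> k, I (p - \sum_(i < size s) c i *: s`_i).

Definition hilb (I : R -> Prop) (d n : nat) : Prop :=
  exists s : seq R, [/\ size s = n, all (fun p => p \is d.-homog) s,
                        indep_mod I s & spans_mod I d s].

Definition maxrank (I : R -> Prop) (d : nat) (F : R) (i : nat) : Prop :=
  (forall g : R, g \is i.-homog -> I (F * g) -> I g) \/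
  (forall q : R, q \is (i + d)%N.-homog ->
     exists g : R, g \is i.-homog /\ I (q - F * g)).

(* coefficient vector of a form of degree d: coordinates indexed by all
   monomials of degree <= d (those of degree < d vanish on forms, so the
   space of forms is a linear subspace of this affine space) *)
Definition coefv (d : nat) (F : R) : 'I_#|{: 'X_{1..r < d.+1}}| -> k :=
  fun i => F@_(val (@enum_val _ {: 'X_{1..r < d.+1}} i)).

(* A property P holds for a general form of degree d: there is a nonempty
   Zariski-open subset U of the space of forms of degree d, namely the
   complement of the common zero locus of a family S of polynomials in the
   coefficients, such that P holds on U. *)
Definition general (d : nat) (P : R -> Prop) : Prop :=
  exists S : {mpoly k[#|{: 'X_{1..r < d.+1}}|]} -> Prop,
    (exists F : R, F \is d.-homog /\ exists G, S G /\ meval (@coefv d F) G != 0) /\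
    (forall F : R, F \is d.-homog ->
       (exists G, S G /\ meval (@coefv d F) G != 0) -> P F).

Definition MRP (I : R -> Prop) : Prop :=
  forall d : nat, (1 <= d)%N ->
    general d (fun F => forall i : nat, maxrank I d F i).

End Defs.
Arguments coefv {k r} d F i.

(* ns = [:: n_d; n_(d-1); ...; n_j] is the d-binomial expansion of n:
   n = C(n_d,d) + ... + C(n_j,j),  n_d > ... > n_j >= j >= 1. *)
Definition dbinom_exp (n d : nat) (ns : seq nat) : Prop :=
  [/\ (0 < size ns <= d)%N, sorted gtn ns,
      (d - (size ns).-1 <= last 0 ns)%N &
      n = (\sum_(q < size ns) 'C(nth 0%N ns q, d - q))%N].

Definition binom_down (d : nat) (ns : seq nat) : nat :=
  (\sum_(q < size ns) 'C((nth 0%N ns q).-1, (d - q).-1))%N.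

(* Main.v *)
(** Write [D d c] for the number of multiples of the last variable among the [c]
    lexicographically smallest monomials of degree [d].  It equals the quantity
    [((c)_(d))^{-1}_{-1}], and Green's hyperplane restriction theorem says that for
    a general linear form [l] the map [l : A_(d-1) -> A_d] has rank at least
    [D d h_d]; in particular [D d h_d <= h_(d-1)], which is Macaulay's theorem.

    Maximal rank is an open condition on the form, so a single form of degree [d]
    suffices for each degree [i], and a product of general linear forms is taken.
    Iterating Green's bound, its rank [A_i -> A_(i+d)] is at least
    [min(h_(i+d), i+1)], and at least [h_i] when [D j h_j = h_(j-1)] for all
    [j <= i + d].  This settles [r = 2], where [h_i <= i + 1], and the second case,
    where [h_(i+d) <= 2] as soon as [i + d >= t].

    Conversely, for [r > 2] the lexsegment ideal with Hilbert function [h], which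
    exists by Macaulay's theorem, is a counterexample.  If [D i h_i < h_(i-1)] with
    [i < t], the monomial in position [D i h_i] of degree [i-1] is a nonzero socle
    element, while no linear form maps onto [A_i], which has [k[x_(r-1), x_r]_i] as
    a quotient.  If [h_t >= 3], a form of degree [t-1] kills [x_1, ..., x_(r-2)],
    hence has rank at most [2] from [A_1] to [A_t]. *)

Require Import Defs.
From HB Require Import structures.
From mathcomp Require Import all_boot all_order all_algebra.
From mathcomp Require Import mpoly zify.
Set Implicit Arguments. Unset Strict Implicit. Unset Printing Implicit Defensive.
Import GRing.Theory.


(** * Lexicographic counting and binomial expansions *)

(* The monomials of degree [d] in [rho + 1] variables, in increasing lexicographic
   order, are those without the first variable followed by the multiples of it;
   [lexw rho d] records which of them are divisible by the last variable. *)
Fixpoint lexw (rho : nat) : nat -> seq bool :=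
  if rho is rho'.+1 then
    fix aux d := if d is d'.+1 then lexw rho' d ++ aux d' else [:: false]
  else fun d => [:: 0 < d].

Definition lexD rho d c := count id (take c (lexw rho d)).

Lemma lexwSS rho d : lexw rho.+1 d.+1 = lexw rho d.+1 ++ lexw rho.+1 d.
Proof. by []. Qed.

Lemma lexw0 rho : lexw rho 0 = [:: false].
Proof. by case: rho. Qed.

Lemma size_lexw rho d : size (lexw rho d) = 'C(rho + d, d).
Proof.
elim: rho d => [|rho IHr] d; first by rewrite binn.
elim: d => [|d IHd]; first by rewrite lexw0 bin0.
by rewrite lexwSS size_cat IHr IHd [in RHS]addSn binS addSnnS.
Qed.

Lemma count_lexw rho d : count id (lexw rho d.+1) = 'C(rho + d, d).
Proof.
elim: rho d => [|rho IHr] d; first by rewrite binn.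
elim: d => [|d IHd]; first by rewrite lexwSS count_cat IHr lexw0 !bin0.
by rewrite lexwSS count_cat IHr IHd [in RHS]addSn binS addSnnS.
Qed.

Lemma lexD_le rho d c : lexD rho d c <= c.
Proof.
apply: leq_trans (count_size _ _) _; rewrite size_take.
by case: ltnP.
Qed.

Lemma lexD0 rho c : lexD rho 0 c = 0.
Proof. by rewrite /lexD lexw0; case: c => [|[]]. Qed.

Lemma lexDn0 rho d : lexD rho d 0 = 0.
Proof. by rewrite /lexD take0. Qed.

Lemma lexD_S rho d c : lexD rho d c <= lexD rho d c.+1 <= (lexD rho d c).+1.
Proof.
rewrite /lexD; have [lt_c|le_c] := ltnP c (size (lexw rho d)).
  rewrite (take_nth false) // -cats1 count_cat /=; case: nth; lia.
by rewrite !take_oversize ?leqnn ?leqnSn // ltnW.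
Qed.

Lemma leq_lexD rho d c c' : c <= c' -> lexD rho d c <= lexD rho d c'.
Proof.
move=> /subnKC <-; elim: (c' - c) => [|n IHn]; first by rewrite addn0.
by rewrite addnS; have /andP[+ _] := lexD_S rho d (c + n); apply: leq_trans.
Qed.

Lemma leq_lexG rho d c c' : c <= c' -> c - lexD rho d c <= c' - lexD rho d c'.
Proof.
move=> /subnKC <-; elim: (c' - c) => [|n IHn]; first by rewrite addn0.
rewrite addnS; have := lexD_S rho d (c + n); have := lexD_le rho d (c + n); lia.
Qed.

(** A new first variable only adds monomials larger than all those in the old variables, and it
    leaves the last variable unchanged. *)
Lemma lexD_widen1 rho d c : c <= 'C(rho + d, d) -> lexD rho.+1 d c = lexD rho d c.
Proof.
case: d => [|d] le_c; first by rewrite !lexD0.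
rewrite /lexD lexwSS take_cat size_lexw; case: ltnP => // ge_c.
have -> : c = 'C(rho + d.+1, d.+1) by lia.
by rewrite subnn take0 cats0 take_oversize // size_lexw.
Qed.

Lemma lexD_split rho d c :
  lexD rho.+1 d.+1 ('C(rho + d.+1, d.+1) + c) = 'C(rho + d, d) + lexD rho.+1 d c.
Proof.
rewrite /lexD lexwSS take_cat size_lexw ltnNge leq_addr /= addKn count_cat.
by rewrite count_lexw.
Qed.

Lemma lexD_full rho d c : 'C(rho + d.+1, d.+1) <= c -> lexD rho d.+1 c = 'C(rho + d, d).
Proof. by move=> le_c; rewrite /lexD take_oversize ?count_lexw // size_lexw. Qed.

Lemma lexD_leq_bin rho d c : lexD rho d.+1 c <= 'C(rho + d, d).
Proof.
rewrite -(count_lexw rho d) /lexD -{2}[lexw _ _](cat_take_drop c).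
by rewrite count_cat leq_addr.
Qed.

Lemma lexD_widen rho rho' d c :
  rho <= rho' -> c <= 'C(rho + d, d) -> lexD rho' d c = lexD rho d c.
Proof.
move=> /subnKC <-; elim: (rho' - rho) => [|n IHn] le_c; first by rewrite addn0.
rewrite addnS lexD_widen1 ?IHn //; apply: leq_trans le_c _.
by apply: leq_bin2l; lia.
Qed.

Lemma lexD1 rho d : lexD rho d.+1 1 = 1.
Proof.
rewrite (@lexD_widen 0) //.
by rewrite binn.
Qed.

Lemma lexD_gt0 rho d c : 0 < c -> 0 < lexD rho d.+1 c.
Proof. by move=> c_gt0; rewrite -(lexD1 rho d) leq_lexD. Qed.

(** In two variables, only the largest monomial, the pure power of the first variable, fails to be a
    multiple of the last. *)
Lemma lexD_diag rho d c : 0 < rho -> c <= d -> lexD rho d c = c.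
Proof.
move=> rho_gt0 le_cd; rewrite (@lexD_widen 1) //; last by rewrite add1n binSn; lia.
elim: d c le_cd => [|d IHd] [|c] le_cd //.
have := lexD_split 0 d c; rewrite !add0n !binn add1n => ->.
by rewrite IHd.
Qed.

(** * The numerical inequality behind Green's theorem *)

Lemma bin_lexw rho d :
  'C(rho.+1 + d.+1, d.+1) = 'C(rho + d.+1, d.+1) + 'C(rho.+1 + d, d).
Proof. by rewrite addSn binS addSnnS. Qed.

Lemma lexG_split rho d c : c <= 'C(rho.+1 + d, d) ->
  ('C(rho + d.+1, d.+1) + c) - lexD rho.+1 d.+1 ('C(rho + d.+1, d.+1) + c)
  = ('C(rho + d.+1, d.+1) - 'C(rho + d, d)) + (c - lexD rho.+1 d c).
Proof.
move=> le_c; rewrite lexD_split.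
have := lexD_le rho.+1 d c.
have: 'C(rho + d, d) <= 'C(rho + d.+1, d.+1).
  by rewrite -[X in X <= _](count_lexw rho d) -size_lexw count_size.
lia.
Qed.

Lemma lexG_leq_bin rho d c : c <= 'C(rho + d.+1, d.+1) ->
  c - lexD rho d.+1 c <= 'C(rho + d.+1, d.+1) - 'C(rho + d, d).
Proof. by move=> le_c; rewrite -(@lexD_full rho d 'C(rho + d.+1, d.+1)) ?leq_lexG. Qed.

(** This refutes the hypothesis of [green_num] at [c' = lexD c - 1], the largest value violating its
    conclusion; smaller values follow by monotonicity. The double induction follows the recursive
    splitting of [lexw]. *)
Lemma green_num_aux rho d c : 0 < c <= 'C(rho + d.+1, d.+1) ->
  (lexD rho d.+1 c).-1 - lexD rho d (lexD rho d.+1 c).-1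
  < lexD rho d.+1 (c - lexD rho d.+1 c).+1.
Proof.
elim: rho d c => [|rho IHr] d c /andP[c_gt0 le_c].
  move: le_c; rewrite binn => le_c; have -> : c = 1 by lia.
  by rewrite !lexD1.
elim: d c c_gt0 le_c => [|d IHd] c c_gt0 le_c.
  have -> : lexD rho.+1 1 c = 1.
    have := lexD_leq_bin rho.+1 0 c; have := lexD_gt0 rho.+1 0 c_gt0.
    by rewrite bin0; lia.
  by rewrite /= sub0n lexD_gt0.
have := lexD_gt0 rho.+1 d.+1 c_gt0.
have [le_c1|lt_c1] := leqP c 'C(rho + d.+2, d.+2).
  have := IHr d.+1 c; rewrite c_gt0 le_c1 => /(_ isT).
  rewrite (lexD_widen1 le_c1) => IH D_gt0.
  have leD := lexD_leq_bin rho d.+1 c.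
  rewrite [lexD rho.+1 d.+1 _]lexD_widen1; last by lia.
  by rewrite lexD_widen1 //; have := lexD_gt0 rho d.+1 c_gt0; lia.
have [x Ex] : exists x, c = 'C(rho + d.+2, d.+2) + x.+1.
  by exists (c - 'C(rho + d.+2, d.+2)).-1; lia.
have le_x : x.+1 <= 'C(rho.+1 + d.+1, d.+1) by move: le_c; rewrite bin_lexw Ex; lia.
have Dx_gt0 : 0 < lexD rho.+1 d.+1 x.+1 by apply: lexD_gt0.
have IH := IHd x.+1 isT le_x.
rewrite Ex lexG_split // lexD_split => _.
set B := 'C(rho + d.+1, d.+1).
set y := lexD rho.+1 d.+1 x.+1 in IH Dx_gt0 *.
have le_y : y <= 'C(rho.+1 + d, d) := lexD_leq_bin _ _ _.
have -> : (B + y).-1 = B + y.-1 by lia.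
rewrite lexG_split; last by lia.
(* [B] is the maximum of [x.+1 - y], by [lexG_leq_bin]. Below it, the argument on the right stays in
   the block without the first variable; at the maximum it is one past that block. *)
have [lt_G|ge_G] := ltnP (x.+1 - y) B.
  have le_B : B <= 'C(rho + d.+2, d.+2).
    by rewrite /B -[X in X <= _](count_lexw rho d.+1) -size_lexw count_size.
  rewrite [lexD _ d.+2 _]lexD_widen1; last by lia.
  rewrite {}/B in lt_G le_B *; clearbody y; clear -IH lt_G le_B.
  case: rho IH lt_G le_B => [|rho] IH lt_G le_B.
    rewrite !add0n !binn in lt_G *; have e1 : x.+1 - y = 0 by lia.
    by move: IH; rewrite e1 subnn !lexD1.
  have -> : ('C(rho.+1 + d.+2, d.+2) - 'C(rho.+1 + d.+1, d.+1) + (x.+1 - y)).+1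
    = 'C(rho + d.+2, d.+2) + (x.+1 - y).+1 by rewrite bin_lexw; lia.
  rewrite lexD_split -(@lexD_widen1 _ _ (x.+1 - y).+1) //.
  have -> : 'C(rho.+1 + d.+1, d.+1) - 'C(rho.+1 + d, d) = 'C(rho + d.+1, d.+1).
    by rewrite bin_lexw addnK.
  by rewrite ltn_add2l.
have le_B : B <= 'C(rho + d.+2, d.+2).
  by rewrite /B -[X in X <= _](count_lexw rho d.+1) -size_lexw count_size.
have bG := lexG_leq_bin le_x; rewrite -/y in bG.
have eG : x.+1 - y = B by move: bG; rewrite bin_lexw -/B; lia.
rewrite eG subnK // -['C(_, _).+1]addn1 lexD_split lexD1.
have : y.-1 - lexD rho.+1 d y.-1 <= 'C(rho + d, d); last first.
  have : 'C(rho + d, d) <= B.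
    by rewrite /B -[X in X <= _](count_lexw rho d) -size_lexw count_size.
  lia.
clearbody y; clear -le_y; case: d le_y => [|d] le_y; first by rewrite !bin0 in le_y *; lia.
apply: leq_trans (lexG_leq_bin _) _; first by lia.
by rewrite bin_lexw; lia.
Qed.

(* The numerical step of Green's theorem: with [c' = rank l] the geometric argument
   yields the hypothesis. *)
Lemma green_num rho d c c' : c <= 'C(rho + d.+1, d.+1) -> c' <= c ->
  lexD rho d.+1 (c - c') <= c' - lexD rho d c' -> lexD rho d.+1 c <= c'.
Proof.
move=> le_c le_c'; case: (posnP c) => [->|c_gt0]; first by rewrite !lexDn0.
apply: contraTT; rewrite -!ltnNge => lt_c'.
have := @green_num_aux rho d c; rewrite c_gt0 le_c => /(_ isT) lt_num.
apply: leq_ltn_trans (leq_trans lt_num _); first by apply: leq_lexG; lia.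
by apply: leq_lexD; have := lexD_le rho d.+1 c; lia.
Qed.


(** * Binomial expansions *)

Lemma lexD_indep rho rho' d c :
  c <= 'C(rho + d, d) -> c <= 'C(rho' + d, d) -> lexD rho d c = lexD rho' d c.
Proof.
move=> le_c le_c'; case/orP: (leq_total rho rho') => le_rho.
  by rewrite (lexD_widen le_rho).
by rewrite (lexD_widen le_rho le_c').
Qed.

Lemma path_gtn_last a ns : path gtn a ns -> last a ns + size ns <= a.
Proof.
by elim: ns a => [|b ns IHns] a /=; [rewrite addn0|case/andP=> lt_ba /IHns]; lia.
Qed.

(** The leading term ['C(b, d)] counts all monomials of degree [d] in [b - d + 1] variables, which
    form an initial block. The rest of the sum continues in degree [d - 1] with one more variable,
    and the bound by ['C(a, d)] guarantees that it fits there. *)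
Lemma binom_down_aux ns d a :
    size ns <= d <= a -> path gtn a ns ->
    (ns = [::] \/ d - (size ns).-1 <= last 0 ns) ->
  let S := \sum_(q < size ns) 'C(nth 0 ns q, d - q) in
  S < 'C(a, d) /\
  (forall rho, S <= 'C(rho + d, d) -> binom_down d ns = lexD rho d S).
Proof.
rewrite /binom_down.
elim: ns d a => [|b ns IHns] d a /andP[le_sd le_da] /=.
  move=> _ _; rewrite !big_ord0 bin_gt0; split=> //.
  by move=> rho _; rewrite lexDn0.
case/andP=> lt_ba ns_path [//|last_ge].
case: d le_sd le_da last_ge => [//|d] le_sd le_da last_ge.
have le_db : d.+1 <= b.
  by have := path_gtn_last ns_path; lia.
have [||S_lt IH] := IHns d b _ ns_path; first by rewrite /= in le_sd; lia.
  by case: (ns) last_ge => [|c ns']; [left|right => /=; move: last_ge => /=; lia].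
rewrite !big_ord_recl /= !subn0.
under eq_bigr do rewrite /bump /= add1n subSS.
set S := \sum_(i < _) _ in S_lt IH *.
split.
  apply: (@leq_trans 'C(b.+1, d.+1)); last exact: leq_bin2l.
  by rewrite binS; lia.
move=> rho le_S.
have Eb : b = (b - d.+1) + d.+1 by lia.
set rho' := b - d.+1 in Eb.
have le_S' : S <= 'C(rho'.+1 + d, d) by rewrite addSnnS -Eb ltnW.
rewrite (@lexD_indep _ rho'.+1) //; last by rewrite bin_lexw -Eb leq_add2l.
rewrite Eb lexD_split -IH // addnS /=; congr (_ + _).
Qed.

Lemma binom_down_lexD rho n d ns :
  dbinom_exp n d ns -> n <= 'C(rho + d, d) -> binom_down d ns = lexD rho d n.
Proof.
case=> /andP[s_gt0 le_sd] ns_sorted last_ge ->.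
have ns_path : path gtn (maxn d (head 0 ns).+1) ns.
  by case: ns ns_sorted {s_gt0 le_sd last_ge} => //= b ns ->; rewrite andbT; lia.
have [| |_ H] := @binom_down_aux ns d _ _ ns_path; [by lia|by right|exact: H].
Qed.

(** The greedy choice takes the largest binomial not exceeding [n]; the bound on the head keeps the
    sequence decreasing when a new term is put in front. *)
Lemma dbinom_exp_ex_lt d rho n : 0 < d -> 0 < n < 'C(rho + d, d) ->
  exists2 ns, dbinom_exp n d ns & head 0 ns < rho + d.
Proof.
elim: d rho n => [//|d IHd]; elim=> [|rho IHr] n _ /andP[n_gt0 n_lt].
  by rewrite binn in n_lt; lia.
have [lt_n|le_n] := ltnP n 'C(rho + d.+1, d.+1).
  by have [||ns ? ?] := IHr n; [|rewrite n_gt0|exists ns => //; lia].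
have [x Ex] : exists x, n = 'C(rho + d.+1, d.+1) + x.
  by exists (n - 'C(rho + d.+1, d.+1)); lia.
have lt_x : x < 'C(rho.+1 + d, d) by move: n_lt; rewrite bin_lexw; lia.
case: (posnP x) => [x0|x_gt0].
  exists [:: rho + d.+1]; last by rewrite /=; lia.
  by split=> //=; [lia | rewrite big_ord_recl big_ord0 /= subn0; lia].
case: (posnP d) => [d0|d_gt0]; first by rewrite d0 bin0 in lt_x; lia.
have [|ns [ns_size ns_sorted ns_last Ens] ns_head] := IHd rho.+1 x d_gt0.
  by rewrite x_gt0.
exists (rho + d.+1 :: ns); last by rewrite /=; lia.
case: ns ns_size ns_sorted ns_last Ens ns_head => [//|b ns] ns_size ns_sorted ns_last Ens ns_head.
split.
- by rewrite /= in ns_size *; lia.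
- by rewrite /= in ns_sorted ns_head *; rewrite ns_sorted; lia.
- by rewrite /= in ns_last *; lia.
rewrite [size _]/= big_ord_recl subn0 Ex Ens; congr (_ + _).
Qed.

Lemma dbinom_exp_ex d n : 0 < d -> 0 < n -> exists ns, dbinom_exp n d ns.
Proof.
move=> d_gt0 n_gt0; have [//||ns] := @dbinom_exp_ex_lt d n n; last by exists ns.
rewrite n_gt0 -bin_sub ?leq_addl // addnK.
have: 'C(n + 1, n) <= 'C(n + d, n) by apply: leq_bin2l; lia.
by rewrite addn1 binSn.
Qed.

(** * Positions of monomials in the lexicographic order *)

(* Position of the monomial with exponent sequence [s] among the monomials of the
   same degree, counted from [0] in increasing lexicographic order: raising the
   exponent of the first variable from [0] to [e] skips the difference of the two
   binomials. *)
Fixpoint lexpos (s : seq nat) : nat :=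
  if s is e :: s' then
    'C(size s' + (e + sumn s'), e + sumn s') - 'C(size s' + sumn s', sumn s')
      + lexpos s'
  else 0.

Lemma lexpos_cons e s :
  lexpos (e :: s) = 'C(size s + (e + sumn s), e + sumn s)
                    - 'C(size s + sumn s, sumn s) + lexpos s.
Proof. by []. Qed.

Lemma leq_bin_deg rho d d' : d <= d' -> 'C(rho + d, d) <= 'C(rho + d', d').
Proof.
move=> le_d; rewrite -bin_sub ?leq_addl // -[X in _ <= X]bin_sub ?leq_addl //.
by rewrite !addnK; apply: leq_bin2l; rewrite leq_add2l.
Qed.

Lemma lexpos0 s : lexpos (0 :: s) = lexpos s.
Proof. by rewrite /= add0n subnn. Qed.

Lemma lexposS rho e s : size s = rho.+1 ->
  lexpos (e.+1 :: s) =
  'C(rho + (e + sumn s).+1, (e + sumn s).+1) + lexpos (e :: s).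
Proof.
move=> size_s; rewrite /= size_s [e.+1 + _]addSn bin_lexw.
have : 'C(rho.+1 + sumn s, sumn s) <= 'C(rho.+1 + (e + sumn s), e + sumn s).
  by apply: leq_bin_deg; lia.
lia.
Qed.

Lemma lexpos_lt rho s : size s = rho.+1 -> lexpos s < 'C(rho + sumn s, sumn s).
Proof.
elim: s rho => [//|e s IHs] [|rho] /= [size_s]; rewrite size_s.
  by rewrite (size0nil size_s) /= !addn0 !add0n !binn.
have := IHs _ size_s; set D := sumn s.
have : 'C(rho + D, D) <= 'C(rho.+1 + D, D) by apply: leq_bin2l; lia.
have : 'C(rho.+1 + D, D) <= 'C(rho.+1 + (e + D), e + D) by apply: leq_bin_deg; lia.
lia.
Qed.

Lemma sumn_incr_nth s i : sumn (incr_nth s i) = (sumn s).+1.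
Proof.
elim: s i => [|e s IHs] [|i] //=; last by rewrite IHs addnS.
by rewrite sumn_ncons mul0n.
Qed.

Lemma lexpos_incr_last s i : i < size s ->
  lexpos (incr_nth s (size s).-1) <= lexpos (incr_nth s i).
Proof.
elim: s i => [//|e [|e' s] IHs] i lt_i; first by case: i lt_i.
rewrite [(size _).-1]/=; case: i lt_i => [|i] lt_i; last first.
  have lt_i' : i < size (e' :: s) by [].
  have := IHs i lt_i'; set t := e' :: s in lt_i' *.
  rewrite (_ : incr_nth (e :: t) (size s).+1 = e :: incr_nth t (size t).-1) //.
  rewrite (_ : incr_nth (e :: t) i.+1 = e :: incr_nth t i) //=.
  by rewrite !sumn_incr_nth !size_incr_nth lt_i' ltnSn; lia.
set t := e' :: s.
rewrite (_ : incr_nth (e :: t) (size s).+1 = e :: incr_nth t (size t).-1) //.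
have lt_t : lexpos (incr_nth t (size t).-1)
    < 'C(size s + (sumn t).+1, (sumn t).+1).
  rewrite -(sumn_incr_nth t (size t).-1); apply: lexpos_lt.
  by rewrite size_incr_nth ltnSn.
rewrite lexpos_cons sumn_incr_nth size_incr_nth ltnSn.
rewrite (_ : incr_nth (e :: t) 0 = e.+1 :: t) // lexpos_cons.
rewrite (addSnnS e); have := bin_lexw (size s) (sumn t).
have : 'C((size s).+1 + (sumn t).+1, (sumn t).+1) <=
       'C((size s).+1 + (e + (sumn t).+1), e + (sumn t).+1).
  by apply: leq_bin_deg; lia.
have Et : size t = (size s).+1 by [].
by clearbody t; rewrite Et in lt_t *; lia.
Qed.

(** Division by the last variable preserves the order, so the multiples of that variable below the
    product of [s] with it correspond to the monomials below [s]. *)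
Lemma lexD_lexpos rho s (p := lexpos (incr_nth s (size s).-1)) :
  size s = rho.+1 ->
  lexD rho (sumn s).+1 p = lexpos s /\ lexD rho (sumn s).+1 p.+1 = (lexpos s).+1.
Proof.
rewrite {}/p; elim: s rho => [//|e s IHs] [|rho] [size_s].
  rewrite (size0nil size_s) /= !addn0 !add0n !binn subnn.
  by rewrite lexDn0 lexD1.
rewrite [(size _).-1]/= size_s.
rewrite (_ : incr_nth (e :: s) rho.+1 = e :: incr_nth s (size s).-1); last first.
  by rewrite size_s.
have size_s' : size (incr_nth s (size s).-1) = rho.+1.
  by rewrite size_incr_nth size_s ltnSn.
elim: e => [|e IHe].
  rewrite !lexpos0 [sumn _]/= add0n.
  have := lexpos_lt size_s'; rewrite sumn_incr_nth => lt_p.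
  by rewrite !lexD_widen1 ?(ltnW lt_p) //; apply: IHs.
rewrite (lexposS _ size_s') (lexposS _ size_s) sumn_incr_nth.
have -> : sumn (e.+1 :: s) = (e + sumn s).+1 by [].
case: IHe; rewrite [sumn _]/= => IH1 IH2.
rewrite (addnS e (sumn s)); split; first by rewrite lexD_split IH1.
by rewrite -[('C(_, _) + _).+1]addnS lexD_split IH2 addnS.
Qed.

Lemma lexpos_ex rho d p : p < 'C(rho + d, d) ->
  exists s, [/\ size s = rho.+1, sumn s = d & lexpos s = p].
Proof.
elim: rho d p => [|rho IHr] d p.
  rewrite binn => lt_p; exists [:: d]; split=> //=; first by rewrite addn0.
  by rewrite !addn0 !add0n !binn; lia.
elim: d p => [|d IHd] p.
  rewrite bin0 => lt_p; have [|s [size_s sum_s Ep]] := IHr 0 p; first by rewrite bin0.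
  exists (0 :: s); split; first by rewrite /= size_s.
    by rewrite /= sum_s.
  by rewrite lexpos0.
move=> lt_p; have [lt_p1|le_p1] := ltnP p 'C(rho + d.+1, d.+1).
  have [s [size_s sum_s Ep]] := IHr _ _ lt_p1.
  exists (0 :: s); split; first by rewrite /= size_s.
    by rewrite /= sum_s.
  by rewrite lexpos0.
have [|s0 [size_s0 sum_s0 Ep0]] := IHd (p - 'C(rho + d.+1, d.+1)).
  by move: lt_p; rewrite bin_lexw; lia.
case: s0 size_s0 sum_s0 Ep0 => [//|e s] [size_s] sum_s Ep.
exists (e.+1 :: s); split; first by rewrite /= size_s.
  by rewrite -sum_s.
by rewrite (lexposS _ size_s) Ep; move: sum_s => /= ->; lia.
Qed.

Lemma lexpos_inj s s' : size s = size s' -> sumn s = sumn s' ->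
  lexpos s = lexpos s' -> s = s'.
Proof.
elim: s s' => [|e s IHs] [|e' s'] // [size_s].
case: s size_s IHs => [|a s] size_s IHs.
  by rewrite (size0nil (esym size_s)) /= !addn0 => ->.
set t := a :: s in size_s IHs *.
have size_t : size t = (size s).+1 by [].
have size_t' : size s' = (size s).+1 by rewrite -size_s.
clearbody t; have sumE x l : sumn (x :: l) = x + sumn l by [].
elim: e e' => [|e IHe] [|e']; rewrite !sumE.
- by rewrite !lexpos0 !add0n => sum_s eq_p; congr (_ :: _); apply: IHs.
- rewrite lexpos0 (lexposS _ size_t') add0n => sum_s.
  have := lexpos_lt size_t; rewrite sum_s addSn; lia.
- rewrite lexpos0 (lexposS _ size_t) add0n => sum_s.
  have := lexpos_lt size_t'; rewrite -sum_s addSn; lia.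
rewrite (lexposS _ size_t) (lexposS _ size_t') !addSn => [[sum_s]].
rewrite sum_s => /addnI eq_p.
by have [-> ->] := IHe e' sum_s eq_p.
Qed.

(** The monomials of degree [d] in the last two variables come first and occupy the positions from
    [0] to [d]. *)
Lemma lexpos_small s i : lexpos s <= sumn s -> i.+2 < size s -> nth 0 s i = 0.
Proof.
elim: s i => [//|e s IHs] i le_s lt_i.
case: e le_s lt_i => [|e] le_s lt_i.
  by case: i lt_i => [//|i] lt_i /=; apply: IHs => //; move: le_s; rewrite lexpos0.
case: s {IHs} lt_i le_s => [//|a [//|b s]] lt_i.
rewrite (@lexposS (size s).+1) //; set t := [:: a, b & s].
have : 'C(1 + (e + sumn t).+1, (e + sumn t).+1)
    <= 'C((size s).+1 + (e + sumn t).+1, (e + sumn t).+1).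
  by apply: leq_bin2l; lia.
rewrite add1n binSn (_ : sumn (e.+1 :: t) = (e + sumn t).+1) //.
by clearbody t; lia.
Qed.

Lemma lexpos_last2 s a b : (forall e, e \in s -> e = 0) -> lexpos (s ++ [:: b; a]) = b.
Proof.
elim: s => [_|e s IHs Hs].
  rewrite cat0s /= !addn0 !add0n !add1n !binSn !binn subnn; lia.
rewrite cat_cons (Hs e) ?mem_head // lexpos0 IHs // => e' e'_s.
by apply: Hs; rewrite inE e'_s orbT.
Qed.

Local Open Scope ring_scope.

(** * Green's theorem *)

Section Generic.
Variable k : fieldType.

Lemma mxrank_minor m n (A : 'M[k]_(m, n)) c : (c <= \rank A)%N ->
  exists L : 'M_(c, m), exists R : 'M_(n, c), L *m A *m R = 1%:M.
Proof.
move=> le_c; exists (pid_mx c *m invmx (col_ebase A)).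
exists (invmx (row_ebase A) *m pid_mx c).
rewrite -{2}(mulmx_ebase A) !mulmxA mulmxKV ?col_ebase_unit //.
rewrite mulmxK ?row_ebase_unit // !mul_pid_mx.
have := rank_leq_row A; have := rank_leq_col A => leA leA'.
rewrite (_ : minn _ _ = c) ?pid_mx_1 //; lia.
Qed.

Lemma mxrank_minorP m n (A : 'M[k]_(m, n)) c (L : 'M_(c, m)) (R : 'M_(n, c)) :
  \det (L *m A *m R) != 0 -> (c <= \rank A)%N.
Proof.
rewrite -unitfE -[X in X \is a _]/(\det _) => det_unit.
have /mxrank_unit <- : L *m A *m R \in unitmx by [].
by apply: leq_trans (mxrankM_maxl _ _) (mxrankM_maxr _ _).
Qed.

Definition evalmx m n (s : k) (P : 'M[{poly k}]_(m, n)) : 'M[k]_(m, n) :=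
  map_mx (horner_eval s) P.

Lemma evalmxM m n p s (P : 'M_(m, n)) (Q : 'M_(n, p)) :
  evalmx s (P *m Q) = evalmx s P *m evalmx s Q.
Proof. exact: map_mxM. Qed.

Lemma evalmxC m n s (A : 'M_(m, n)) : evalmx s (map_mx polyC A) = A.
Proof. by apply/matrixP => i j; rewrite !mxE /horner_eval hornerC. Qed.

Definition linemx m n (A B : 'M[k]_(m, n)) : 'M[{poly k}]_(m, n) :=
  map_mx polyC A + 'X *: map_mx polyC (B - A).

Lemma eval_linemx m n s (A B : 'M_(m, n)) :
  evalmx s (linemx A B) = A + s *: (B - A).
Proof.
by apply/matrixP => i j; rewrite !mxE /horner_eval hornerE hornerM !hornerC hornerX.
Qed.

Lemma mxrank_open m n (P : 'M_(m, n)) s0 c : (c <= \rank (evalmx s0 P))%N ->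
  exists2 f : {poly k}, f != 0 &
    forall s, f.[s] != 0 -> (c <= \rank (evalmx s P))%N.
Proof.
case/mxrank_minor=> L [R eq1].
pose f := \det (map_mx polyC L *m P *m map_mx polyC R).
have fE s : f.[s] = \det (L *m evalmx s P *m R).
  by rewrite -[LHS]/(horner_eval s f) -det_map_mx -/(evalmx s _) !evalmxM !evalmxC.
exists f => [|s]; last by rewrite fE; apply: mxrank_minorP.
apply/eqP => f0; have := fE s0; rewrite f0 horner0 eq1 det1.
by move/eqP; rewrite eq_sym oner_eq0.
Qed.

Hypothesis k_char0 : [pchar k] =i pred0.

Lemma poly_nonroot (f : {poly k}) : f != 0 -> exists s, f.[s] != 0.
Proof.
move=> f_neq0; pose rs := [seq i%:R : k | i <- iota 0 (size f)].
have rs_uniq : uniq rs.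
  rewrite map_inj_in_uniq ?iota_uniq // => i j _ _.
  wlog le_ij : i j / (i <= j)%N => [IH eq_ij|/eqP].
    by case/orP: (leq_total i j) => /IH; [apply|move/(_ (esym eq_ij))].
  rewrite eq_sym -subr_eq0 -natrB // (pcharf0P k).1 //; lia.
have [/allP rs_root|/allPn[s _ Hs]] := boolP (all (root f) rs); last by exists s.
have /(_ (introT allP rs_root)) := max_poly_roots f_neq0 _ rs_uniq.
by rewrite size_map size_iota ltnn.
Qed.

End Generic.

Section Green.
(** Rows are linear functionals: [C i] is the transpose of multiplication by the [i]-th variable and
    [H d] spans the functionals of degree [d]. The hypothesis [C_inj] reflects that the variables
    generate all forms of positive degree. *)
Variables (k : fieldType) (r N : nat) (C : 'I_r -> 'M[k]_N) (H : nat -> 'M[k]_N).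
Hypothesis k_char0 : [pchar k] =i pred0.
Hypothesis C_comm : forall i j, C i *m C j = C j *m C i.
Hypothesis C_H : forall d i, (H d.+1 *m C i <= H d)%MS.
Hypothesis C_inj : forall d (w : 'rV_N),
  (w <= H d.+1)%MS -> (forall i, w *m C i = 0) -> w = 0.

Definition Cv (v : 'rV[k]_r) : 'M_N := \sum_i v 0 i *: C i.

Lemma Cv_comm v w : Cv v *m Cv w = Cv w *m Cv v.
Proof.
rewrite /Cv mulmx_suml [RHS]mulmx_sumr; apply: eq_bigr => i _.
rewrite mulmx_sumr [RHS]mulmx_suml; apply: eq_bigr => j _.
by rewrite -!scalemxAl -!scalemxAr C_comm !scalerA mulrC.
Qed.

Lemma Cv_line s v w : Cv (v + s *: (w - v)) = Cv v + s *: (Cv w - Cv v).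
Proof.
rewrite /Cv -sumrB scaler_sumr -big_split; apply: eq_bigr => i _ /=.
by rewrite !mxE scalerDl -!scalerA scalerBl.
Qed.

Lemma Cv_H n (W : 'M_(n, N)) d v : (W <= H d.+1)%MS -> (W *m Cv v <= H d)%MS.
Proof.
move=> leW; rewrite /Cv mulmx_sumr; apply: summx_sub => i _.
rewrite -scalemxAr; apply: scalemx_sub.
by apply: submx_trans (C_H d i); apply: submxMr.
Qed.

Lemma Cv_gt0 n (W : 'M_(n, N)) d : (W <= H d.+1)%MS -> (0 < \rank W)%N ->
  exists v, (0 < \rank (W *m Cv v))%N.
Proof.
move=> leW; rewrite lt0n mxrank_eq0 => W_neq0.
have [i Wi] : exists i, W *m C i != 0.
  apply/existsP; apply: contraNT W_neq0; rewrite negb_exists => /forallP WC.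
  apply/eqP/row_matrixP => j; rewrite row0; apply: (@C_inj d).
    by apply: submx_trans leW; apply: row_sub.
  move=> i; rewrite -row_mul; have := WC i; rewrite negbK => /eqP ->.
  by rewrite row0.
exists (delta_mx 0 i); rewrite lt0n mxrank_eq0.
suff -> : Cv (delta_mx 0 i) = C i by [].
rewrite /Cv (bigD1 i) //= mxE !eqxx scale1r big1 ?addr0 // => j.
by rewrite mxE eq_sym => /negbTE->; rewrite andbF scale0r.
Qed.

(** The pair is taken on the line joining [(v1, v1')] to [(v2, v2')]. Each of the four ranks can
    drop below its value at the relevant end only at finitely many parameters, and the field is
    infinite. *)
Lemma Cv_generic n (W : 'M_(n, N)) v1 v1' v2 v2' :
  exists v, exists v', [/\
    (\rank (W *m Cv v1') <= \rank (W *m Cv v'))%N,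
    (\rank (W *m Cv v1' *m Cv v1) <= \rank (W *m Cv v' *m Cv v))%N,
    (\rank (W *m Cv v2) <= \rank (W *m Cv v))%N &
    (\rank (W *m row_mx (Cv v2) (Cv v2')) <=
     \rank (W *m row_mx (Cv v) (Cv v')))%N].
Proof.
pose pt s := (v1 + s *: (v2 - v1), v1' + s *: (v2' - v1')).
pose L := linemx (Cv v1) (Cv v2); pose L' := linemx (Cv v1') (Cv v2').
pose W' := map_mx polyC W.
have EL s : evalmx s L = Cv (pt s).1 by rewrite eval_linemx -Cv_line.
have EL' s : evalmx s L' = Cv (pt s).2 by rewrite eval_linemx -Cv_line.
have EW s : evalmx s W' = W by rewrite evalmxC.
have ER s : evalmx s (row_mx L L') = row_mx (Cv (pt s).1) (Cv (pt s).2).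
  by rewrite /evalmx map_row_mx -/(evalmx s L) -/(evalmx s L') EL EL'.
have p0 : pt 0 = (v1, v1') by rewrite /pt !scale0r !addr0.
have p1 : pt 1 = (v2, v2') by rewrite /pt !scale1r !(addrC _ (_ - _)) !subrK.
have [f1 f1n0 f1P] := mxrank_open (leqnn (\rank (evalmx 0 (W' *m L')))).
have [f2 f2n0 f2P] := mxrank_open (leqnn (\rank (evalmx 0 (W' *m L' *m L)))).
have [f3 f3n0 f3P] := mxrank_open (leqnn (\rank (evalmx 1 (W' *m L)))).
have [f4 f4n0 f4P] := mxrank_open (leqnn (\rank (evalmx 1 (W' *m row_mx L L')))).
have [s] : exists s, (f1 * f2 * f3 * f4).[s] != 0.
  by apply: poly_nonroot; rewrite // !mulf_neq0.
rewrite !hornerM !mulf_eq0 !negb_or => /andP[/andP[/andP[/f1P g1 /f2P g2] /f3P g3] /f4P g4].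
exists (pt s).1; exists (pt s).2.
by move: g1 g2 g3 g4; rewrite !evalmxM !EW !ER !EL !EL' p0 p1.
Qed.

(** The kernel of [A] in [W] moves with [A], so semicontinuity does not apply directly to the rank
    of [B] on it; this formula recovers that rank from matrices that vary polynomially. *)
Lemma mxrank_row_mx n m1 m2 (W : 'M[k]_(n, N)) (A : 'M_(N, m1)) (B : 'M_(N, m2)) :
  \rank (W *m row_mx A B) = (\rank (W *m A) + \rank ((W :&: kermx A)%MS *m B))%N.
Proof.
have e1 := mxrank_mul_ker W A; have e2 := mxrank_mul_ker (W :&: kermx A)%MS B.
have e3 := mxrank_mul_ker W (row_mx A B).
suff /eqmx_rank e4 : (W :&: kermx A :&: kermx B == W :&: kermx (row_mx A B))%MS by lia.
apply/andP; split.
  rewrite sub_capmx (submx_trans (capmxSl _ _) (capmxSl _ _)) /=.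
  apply/sub_kermxP; rewrite mul_mx_row.
  rewrite (sub_kermxP (capmxSr _ _)) (sub_kermxP _) ?row_mx0 //.
  exact: submx_trans (capmxSl _ _) (capmxSr _ _).
have /sub_kermxP := capmxSr W (kermx (row_mx A B)).
rewrite mul_mx_row -row_mx0 => /eq_row_mx[/sub_kermxP kA /sub_kermxP kB].
by rewrite !sub_capmx capmxSl kA kB.
Qed.

(* Green's argument: on the kernel [K] of [Cv v] in [W], for a general pair [(v, v')]
   of vectors, [Cv v'] has rank at least [lexD rho d.+1 (dim K)], and it maps [K] into
   the kernel of [Cv v] in [W *m Cv v']. *)
Lemma green_step rho d n (W : 'M_(n, N)) v0 (c0 := \rank (W *m Cv v0)) v1 v2 :
    (\rank W <= 'C(rho + d.+1, d.+1))%N ->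
    (lexD rho d c0 <= \rank (W *m Cv v0 *m Cv v1))%N ->
    (lexD rho d.+1 (\rank W - c0) <=
     \rank ((W :&: kermx (Cv v0))%MS *m Cv v2))%N ->
    (c0 < lexD rho d.+1 (\rank W))%N ->
  exists v, (c0 < \rank (W *m Cv v))%N.
Proof.
move=> leN ge1 ge2 lt_c0.
(* The line runs from [(v1, v0)], which controls the product [Cv v' *m Cv v], to [(v0, v2)], which
   controls [Cv v'] on the kernel of [Cv v]. *)
have [v [v' [ge_v' ge_vv' ge_v ge_row]]] := Cv_generic W v1 v0 v0 v2.
have [gt_v|le_v] := ltnP c0 (\rank (W *m Cv v)); first by exists v.
have [gt_v'|le_v'] := ltnP c0 (\rank (W *m Cv v')); first by exists v'.
have eq_v : \rank (W *m Cv v) = c0 by apply/eqP; rewrite eqn_leq le_v.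
have eq_v' : \rank (W *m Cv v') = c0 by apply/eqP; rewrite eqn_leq le_v'.
move: ge_row; rewrite !mxrank_row_mx eq_v leq_add2l => ge_K.
have le_K : (\rank ((W :&: kermx (Cv v))%MS *m Cv v')
    <= \rank (W *m Cv v' :&: kermx (Cv v))%MS)%N.
  apply/mxrankS; rewrite sub_capmx submxMr ?capmxSl //=; apply/sub_kermxP.
  by rewrite -mulmxA Cv_comm mulmxA (sub_kermxP (capmxSr _ _)) mul0mx.
have := mxrank_mul_ker (W *m Cv v') (Cv v); rewrite eq_v' => e1.
have le_c0 : (c0 <= \rank W)%N by rewrite -eq_v mxrankM_maxl.
suff: (lexD rho d.+1 (\rank W) <= c0)%N by rewrite leqNgt lt_c0.
by apply: (green_num leN) => //; lia.
Qed.

(* Green's hyperplane restriction theorem in dual form: [W] spans linear functionals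
   on forms of degree [d + 1], and [Cv v] is the transpose of multiplication by a
   linear form. *)
Theorem green rho d n (W : 'M_(n, N)) :
  (W <= H d.+1)%MS -> (\rank W <= 'C(rho + d.+1, d.+1))%N ->
  exists v, (lexD rho d.+1 (\rank W) <= \rank (W *m Cv v))%N.
Proof.
move: d n W; elim=> [|d IHd] n W.
  move=> leW _; case: (posnP (\rank W)) => [->|/(Cv_gt0 leW)[v v_gt0]].
    by exists 0; rewrite lexDn0.
  by exists v; apply: leq_trans (lexD_leq_bin _ _ _) _; rewrite bin0.
(* The induction on the rank applies to the kernel of [Cv v0], which is smaller because [Cv v0] is
   nonzero on [W]. A third induction, on the gap to the bound, replaces [v0] by a vector of larger
   rank. *)
have [m] := ubnP (\rank W); elim: m n W => // m IHm n W lt_m leW leN.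
have [W0|/(Cv_gt0 leW)[v0]] := posnP (\rank W).
  by exists 0; rewrite W0 lexDn0.
have [g] := ubnP (lexD rho d.+2 (\rank W) - \rank (W *m Cv v0)).
elim: g v0 => // g IHg v0 lt_g v0_gt0.
have [le_v0|lt_v0] := leqP (lexD rho d.+2 (\rank W)) (\rank (W *m Cv v0)).
  by exists v0.
have [||v1 ge1] := IHd _ (W *m Cv v0); first exact: Cv_H.
  exact: leq_trans (ltnW lt_v0) (lexD_leq_bin _ _ _).
have e1 := mxrank_mul_ker W (Cv v0).
have eK : \rank (W :&: kermx (Cv v0))%MS = (\rank W - \rank (W *m Cv v0))%N by lia.
have [||| v2] := IHm _ (W :&: kermx (Cv v0))%MS; try by lia.
  exact: submx_trans (capmxSl _ _) leW.
rewrite eK => ge2.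
have [v gt_v] := green_step leN ge1 ge2 lt_v0.
by apply: (IHg v) => //; lia.
Qed.
End Green.


(** * Multiplication matrices and the Hilbert function *)

Section Coefficients.
Variables (k : fieldType) (r m : nat).
Local Notation R := {mpoly k[r]}.
Local Notation T := 'X_{1..r < m.+1}.
Local Notation N := #|{: T}|.
Implicit Types (p q F G : R).

(** Truncating at degree [m] lets all degrees up to [m] share one matrix size; the enumeration is
    the one used in [coefv]. *)
Definition mon (a : 'I_N) : 'X_{1..r} := val (@enum_val _ {: T} a).

Lemma mon_deg a : (mdeg (mon a) <= m)%N.
Proof. by rewrite -ltnS bmdeg. Qed.

Lemma mon_inj : injective mon.
Proof. by move=> a b /val_inj/enum_val_inj. Qed.

Lemma mon_ex u : (mdeg u <= m)%N -> exists a, mon a = u.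
Proof.
rewrite -ltnS => lt_u; exists (enum_rank_in (erefl (BMultinom lt_u \in {: T})) (BMultinom lt_u)).
by rewrite /mon enum_rankK_in.
Qed.

Lemma big_mon (V : nmodType) (P : pred 'X_{1..r}) (f : 'X_{1..r} -> V) :
  \sum_(a < N | P (mon a)) f (mon a) = \sum_(u : T | P u) f u.
Proof.
by rewrite [RHS](reindex _ (onW_bij _ (@enum_val_bij T))).
Qed.

Definition cvec p : 'cV[k]_N := \col_a p@_(mon a).
Definition polyv (g : 'cV[k]_N) : R := \sum_a g a 0 *: 'X_[mon a].
(* Multiplication by [F] on polynomials modulo degree [> m]; it acts on functionals,
   written as rows, by right multiplication. *)
Definition Cf F : 'M[k]_N := \matrix_(a, b) (F * 'X_[mon b])@_(mon a).
Definition Hd (d : nat) : 'M[k]_N :=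
  diag_mx (\row_a (mdeg (mon a) == d)%:R).

Lemma cvec_is_linear : linear cvec.
Proof. by move=> c p q; apply/colP => a; rewrite !mxE mcoeffD mcoeffZ. Qed.
HB.instance Definition _ := GRing.isLinear.Build k R 'cV[k]_N _ cvec cvec_is_linear.

Lemma Cf_is_linear : linear Cf.
Proof.
by move=> c p q; apply/matrixP => a b; rewrite !mxE mulrDl -scalerAl mcoeffD mcoeffZ.
Qed.
HB.instance Definition _ := GRing.isLinear.Build k R 'M[k]_N _ Cf Cf_is_linear.

Lemma polyvK g : cvec (polyv g) = g.
Proof.
apply/colP => a; rewrite mxE raddf_sum (bigD1 a) //= mcoeffZ mcoeffX eqxx mulr1.
rewrite big1 ?addr0 // => b ne_ba; rewrite mcoeffZ mcoeffX.
by rewrite (inj_eq mon_inj) (negbTE ne_ba) mulr0.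
Qed.

Lemma mcoeff_CfE F (a b : 'I_N) :
  (F * 'X_[mon b])@_(mon a) = if (mon b <= mon a)%MM then F@_(mon a - mon b) else 0.
Proof.
rewrite -[LHS]/((mpoly_mul F 'X_[mon b])@_(mon a)).
rewrite (@mcoeff_poly_mul_lin_rev _ _ _ _ _ m.+1) ?ltnS ?mon_deg //.
rewrite -(big_mon (fun u => u <= mon a)%MM (fun u => F@_(mon a - u) * 'X_[mon b]@_u)).
rewrite big_mkcond (bigD1 b) //= mcoeffX eqxx mulr1 big1 ?addr0 // => c ne_cb.
by rewrite mcoeffX (inj_eq mon_inj) eq_sym (negbTE ne_cb) mulr0 if_same.
Qed.

Lemma Cf_cvec F p : Cf F *m cvec p = cvec (F * p).
Proof.
apply/colP => a; rewrite !mxE.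
rewrite -[RHS]/((mpoly_mul F p)@_(mon a)).
rewrite (@mcoeff_poly_mul_lin_rev _ _ _ _ _ m.+1) ?ltnS ?mon_deg //.
rewrite -(big_mon (fun u => u <= mon a)%MM (fun u => F@_(mon a - u) * p@_u)).
rewrite [RHS]big_mkcond; apply: eq_bigr => b _; rewrite !mxE mcoeff_CfE.
by case: ifP; rewrite // mul0r.
Qed.

Lemma CfM F G : Cf (F * G) = Cf F *m Cf G.
Proof.
apply/matrixP => a b; have /colP/(_ a) := Cf_cvec F (G * 'X_[mon b]).
rewrite !mxE mulrA => <-; apply: eq_bigr => c _.
by rewrite !mxE.
Qed.

Lemma HdP n (W : 'M_(n, N)) d :
  reflect (forall j a, mdeg (mon a) != d -> W j a = 0) (W <= Hd d)%MS.
Proof.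
apply: (iffP idP) => [/submxP[B ->] j a ne_a|W0].
  by rewrite /Hd mul_mx_diag !mxE (negbTE ne_a) mulr0.
apply/submxP; exists W; apply/matrixP => j a; rewrite /Hd mul_mx_diag !mxE.
by case: eqP => [_|/eqP/W0->]; rewrite ?mulr1 ?mul0r.
Qed.

Lemma mul_Hd n (W : 'M_(n, N)) d : (W <= Hd d)%MS -> W *m Hd d = W.
Proof.
move/HdP=> W0; apply/matrixP => j a; rewrite /Hd mul_mx_diag !mxE.
by case: eqP => [_|/eqP/W0->]; rewrite ?mulr1 ?mul0r.
Qed.

Lemma dhomog_polyv_Hd d g : polyv (Hd d *m g) \is d.-homog.
Proof.
rewrite /polyv; apply: rpred_sum => a _; rewrite /Hd mul_diag_mx !mxE.
case: eqP => [deg_a|_]; last by rewrite mul0r scale0r rpred0.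
by apply: rpredZ; rewrite dhomogX; apply/eqP.
Qed.

Lemma Cf_Hd n (W : 'M_(n, N)) i d F : F \is d.-homog ->
  (W <= Hd (i + d))%MS -> (W *m Cf F <= Hd i)%MS.
Proof.
move=> hF /HdP W0; apply/HdP => j b ne_b; rewrite mxE big1 // => a _.
have [deg_a|/W0->] := eqVneq (mdeg (mon a)) (i + d)%N; last by rewrite mul0r.
rewrite mxE (@dhomog_nemf_coeff _ _ mdeg (d + mdeg (mon b))) ?mulr0 //.
  by apply: dhomogM => //; rewrite dhomogX.
by rewrite /= deg_a addnC eqn_add2l eq_sym.
Qed.

Lemma dhomog_cvec_eq d p : p \is d.-homog -> (d <= m)%N ->
  p = \sum_(a < N) p@_(mon a) *: 'X_[mon a].
Proof.
move=> hp le_d; rewrite (big_mon xpredT (fun u => p@_u *: 'X_[u])).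
apply: mpolywE; apply/bigmax_leqP_seq => u u_p _.
by rewrite (dhomog_mf hp).
Qed.

End Coefficients.

Arguments Cf {k r} m F.
Arguments cvec {k r} m p.
Arguments Hd {k r} m d.

(** * Green's bound for products of linear forms *)

Section IteratedGreen.
Variables (k : fieldType) (r m : nat).
Hypothesis k_char0 : [pchar k] =i pred0.
Local Notation R := {mpoly k[r.+1]}.
Local Notation N := #|{: 'X_{1..r.+1 < m.+1}}|.

Lemma Cf_comm (F G : R) : Cf m F *m Cf m G = Cf m G *m Cf m F.
Proof. by rewrite -!CfM mulrC. Qed.

Lemma lin_homog (v : 'rV[k]_r.+1) : \sum_i v 0 i *: 'X_i \is [in k[r.+1], 1.-homog].
Proof. by apply: rpred_sum => i _; apply: rpredZ; rewrite dhomogX /= mdeg1. Qed.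

Lemma card_mon_deg d :
  (#|[pred a : 'I_N | mdeg (mon a) == d]| <= 'C(r + d, d))%N.
Proof.
(* The codomain has one extra element so that [inord] applies; it is never attained and is
   discounted at the end. *)
pose f (a : 'I_N) : 'I_('C(r + d, d).+1) := inord (lexpos (mon a)).
have fE a : mdeg (mon a) = d -> f a = lexpos (mon a) :> nat /\ (f a < 'C(r + d, d))%N.
  move=> deg_a; have : (lexpos (mon a) < 'C(r + d, d))%N.
    by rewrite -deg_a /mdeg -sumnE; apply: lexpos_lt; rewrite size_tuple.
  by move=> lt_a; rewrite /f inordK // ltnW.
have f_inj : {in [pred a : 'I_N | mdeg (mon a) == d] &, injective f}.
  move=> a b /eqP deg_a /eqP deg_b eq_f; apply/mon_inj/val_inj/val_inj/lexpos_inj.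
  - by rewrite !size_tuple.
  - by rewrite !sumnE -!/(mdeg _) deg_a.
  by rewrite -(fE a deg_a).1 -(fE b deg_b).1 eq_f.
rewrite -(card_in_image f_inj) -[X in (_ <= X)%N]subn0 -ltnS -subSn // subn0.
have := max_card [predU1 ord_max & [seq f a | a in [pred a : 'I_N | mdeg (mon a) == d]]].
rewrite card_ord cardU1; case: imageP => //= -[a /eqP deg_a e].
by have := (fE a deg_a).2; rewrite -e ltnn.
Qed.

Lemma rank_Hd_le n (W : 'M[k]_(n, N)) d : (W <= Hd m d)%MS -> (\rank W <= 'C(r + d, d))%N.
Proof.
move=> /HdP W0; apply: leq_trans (card_mon_deg d).
set D := [pred a | _].
pose W1 : 'M[k]_(n, #|D|) := \matrix_(j, x) W j (enum_val x).
pose W2 : 'M[k]_(#|D|, N) := \matrix_(x, a) (enum_val x == a)%:R.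
suff -> : W = W1 *m W2 by apply: mulmx_max_rank.
apply/matrixP => j a; rewrite mxE.
have [deg_a|/[dup]/W0-> ne_a] := eqVneq (mdeg (mon a)) d; last first.
  rewrite big1 // => x _; rewrite !mxE; case: eqP => [e|]; rewrite ?mulr0 //.
  by have := enum_valP x; rewrite e inE (negbTE ne_a).
have Da : a \in D by rewrite inE deg_a.
rewrite (bigD1 (enum_rank_in Da a)) //= !mxE enum_rankK_in // eqxx mulr1.
rewrite big1 ?addr0 // => x ne_x; rewrite !mxE; case: eqP => [e|]; rewrite ?mulr0 //.
by case/eqP: ne_x; apply: enum_val_inj; rewrite enum_rankK_in.
Qed.

Lemma CvE (v : 'rV[k]_r.+1) :
  Cv (fun i => Cf m ('X_i : R)) v = Cf m (\sum_i v 0 i *: 'X_i).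
Proof. by rewrite /Cv linear_sum; apply: eq_bigr => i _; rewrite linearZ. Qed.

Lemma green_mpoly d n (W : 'M[k]_(n, N)) : (W <= Hd m d.+1)%MS ->
  exists2 l : R, l \is 1.-homog & (lexD r d.+1 (\rank W) <= \rank (W *m Cf m l))%N.
Proof.
move=> leW.
have [||||||v] := @green k r.+1 N (fun i => Cf m ('X_i : R)) (Hd m) _ _ _ _ r d n W.
- exact: k_char0.
- by move=> i j; apply: Cf_comm.
- by move=> c i; apply: (@Cf_Hd _ _ _ _ _ _ 1%N); rewrite ?addn1 // dhomogX /= mdeg1.
(* A monomial of positive degree is divisible by some variable, and the entry of [w] there is read
   off from the product of [w] with the matrix of that variable. *)
- move=> c w /HdP w0 wC; apply/rowP => a; rewrite mxE.
  have [deg_a|/w0->//] := eqVneq (mdeg (mon a)) c.+1.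
  have [i ai] : exists i, mon a i != 0%N.
    apply/existsP; apply: contraTT (ltn0Sn c) => /existsPn a0.
    rewrite -deg_a mdegE big1 // => i _; apply/eqP; have := a0 i.
    by rewrite negbK.
  have le_ia : (U_(i) <= mon a)%MM by rewrite lep1mP.
  have [|b Eb] := @mon_ex r.+1 m (mon a - U_(i))%MM.
    by apply: leq_trans (mdegB _ _) (mon_deg _).
  have /rowP/(_ b) := wC i; rewrite !mxE (bigD1 a) //= big1 ?addr0.
    by rewrite mxE Eb -mpolyXD addmC submK // mcoeffX eqxx mulr1.
  move=> a' ne_a; rewrite mxE Eb -mpolyXD addmC submK // mcoeffX.
  by rewrite (inj_eq (@mon_inj _ _)) eq_sym (negbTE ne_a) mulr0.
- exact: leW.
- exact: rank_Hd_le.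
by rewrite CvE => ge_v; exists (\sum_i v 0 i *: 'X_i) => //; apply: lin_homog.
Qed.

Fixpoint lexDiter i d c : nat :=
  if d is d'.+1 then lexDiter i d' (lexD r (i + d) c) else c.

Lemma leq_lexDiter i d c c' : (c <= c')%N -> (lexDiter i d c <= lexDiter i d c')%N.
Proof. by elim: d c c' => //= d IHd c c' le_c; apply/IHd/leq_lexD. Qed.

Lemma green_iter i d n (W : 'M[k]_(n, N)) : (W <= Hd m (i + d))%MS ->
  exists2 F : R, F \is d.-homog & (lexDiter i d (\rank W) <= \rank (W *m Cf m F))%N.
Proof.
elim: d n W => [|d IHd] n W.
  exists 1; first exact: dhomog1.
  suff -> : Cf m (1 : R) = 1%:M by rewrite mulmx1.
  apply/matrixP => a b; rewrite !mxE mul1r mcoeffX (inj_eq (@mon_inj _ _)) eq_sym.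
  by [].
rewrite addnS => leW; have [l hl ge_l] := green_mpoly leW.
have [|F hF ge_F] := IHd _ (W *m Cf m l).
  by apply: (Cf_Hd hl); rewrite addn1.
exists (l * F); first exact: (dhomogM hl hF).
rewrite CfM mulmxA; apply: leq_trans ge_F => /=.
by rewrite addnS; apply: leq_lexDiter.
Qed.

End IteratedGreen.


Lemma mulmx_col (S : pzSemiRingType) m n p (A : 'M[S]_(m, n)) (B : 'M_(n, p)) j :
  A *m col j B = col j (A *m B).
Proof. by rewrite !colE mulmxA. Qed.

(** * Matrices of graded quotients and openness of maximal rank *)

Section HilbertMatrix.
Variables (k : fieldType) (r : nat).
Local Notation R := {mpoly k[r]}.
Variable I : R -> Prop.
Hypothesis I_ideal : homog_ideal I.

Let I0 : I 0. Proof. by case: I_ideal. Qed.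
Let ID p q : I p -> I q -> I (p + q). Proof. by case: I_ideal => _ H _ _; apply: H. Qed.
Let IM p q : I q -> I (p * q). Proof. by case: I_ideal => _ _ H _; apply: H. Qed.
Let IZ c p : I p -> I (c *: p).
Proof. by rewrite -mul_mpolyC; apply: IM. Qed.
Let IB p q : I p -> I q -> I (p - q).
Proof. by move=> Ip Iq; apply: ID => //; rewrite -scaleN1r; apply: IZ. Qed.
Let Isum (J : Type) (s : seq J) (P : pred J) (F : J -> R) :
  (forall j, P j -> I (F j)) -> I (\sum_(j <- s | P j) F j).
Proof. by move=> IF; apply: big_ind => //; apply: ID. Qed.

(* The columns of [W] are the coordinates of the monomials in the quotient by [I] in
   degree [d]. *)
Definition quotmx m d n (W : 'M[k]_(n, #|{: 'X_{1..r < m.+1}}|)) : Prop :=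
  [/\ (W <= Hd m d)%MS, row_free W &
      forall p, p \is d.-homog -> (I p <-> W *m cvec m p = 0)].

(** Each column expands a monomial of degree [d] in a basis of the quotient. The matrix sends the
    basis itself to the identity, hence has full row rank. *)
Lemma hilb_quotmx m d n : (d <= m)%N -> hilb I d n ->
  exists W : 'M[k]_(n, #|{: 'X_{1..r < m.+1}}|), quotmx d W.
Proof.
move=> le_dm [s [<- /allP s_homog s_indep s_span]].
have [c cP] : exists c : 'I_#|{: 'X_{1..r < m.+1}}| -> 'I_(size s) -> k, forall a,
    mdeg (mon a) = d -> I ('X_[mon a] - \sum_(j < size s) c a j *: s`_j).
  apply: (@fin_all_exists _ _ (fun a c => mdeg (mon a) = d ->
     I ('X_[mon a] - \sum_(j < size s) c j *: s`_j))) => a.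
  have [deg_a|ne_a] := eqVneq (mdeg (mon a)) d; last first.
    by exists (fun=> 0) => deg_a; rewrite deg_a eqxx in ne_a.
  have [|c Ic] := s_span 'X_[mon a]; first by rewrite dhomogX; apply/eqP.
  by exists c.
pose W : 'M[k]_(size s, #|{: 'X_{1..r < m.+1}}|) :=
  \matrix_(j, a) if mdeg (mon a) == d then c a j else 0.
have red p : p \is d.-homog ->
    I (p - \sum_(j < size s) (W *m cvec m p) j 0 *: s`_j).
  move=> hp; rewrite {1}(dhomog_cvec_eq hp le_dm).
  under [X in _ - X]eq_bigr do rewrite mxE scaler_suml.
  rewrite exchange_big -sumrB; apply: Isum => a _.
  have [deg_a|ne_a] := eqVneq (mdeg (mon a)) d; last first.
    rewrite (dhomog_nemf_coeff hp ne_a) scale0r sub0r -scaleN1r; apply: IZ.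
    by rewrite big1 // => j _; rewrite !mxE (negbTE ne_a) mul0r scale0r.
  have /(IZ p@_(mon a)) := cP a deg_a; rewrite scalerBr scaler_sumr.
  congr (I (_ - _)); apply: eq_bigr => j _.
  by rewrite !mxE deg_a eqxx scalerA mulrC.
have redE p : p \is d.-homog -> I p -> W *m cvec m p = 0.
  move=> hp Ip; apply/colP => j; rewrite [RHS]mxE.
  apply: (s_indep (fun j => (W *m cvec m p) j 0)).
  by rewrite -[X in I X](subKr p); apply: IB => //; apply: red.
exists W; split.
- by apply/HdP => j a ne_a; rewrite mxE (negbTE ne_a).
- apply/row_freeP; exists (\matrix_(a, j) s`_j@_(mon a)).
  apply/matrixP => i j; rewrite [RHS]mxE.
  have hsj : s`_j \is d.-homog by apply/s_homog/mem_nth.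
  have Ecol : (W *m \matrix_(a, j) s`_j@_(mon a)) i j = (W *m cvec m s`_j) i 0.
    by rewrite !mxE; apply: eq_bigr => a _; rewrite !mxE.
  rewrite Ecol; apply/eqP; rewrite eq_sym -subr_eq0; apply/eqP.
  apply: (s_indep (fun i => (i == j)%:R - (W *m cvec m s`_j) i 0)).
  have := red _ hsj; congr (I _).
  under [RHS]eq_bigr do rewrite scalerBl.
  rewrite sumrB; congr (_ - _); rewrite (bigD1 j) //= eqxx scale1r big1 ?addr0 //.
  by move=> l /negbTE->; rewrite scale0r.
move=> p hp; split; first exact: redE.
move=> W0; have := red p hp; rewrite big1 ?subr0 // => j _.
by rewrite W0 mxE scale0r.
Qed.

(** Since [F] maps the ideal into itself, a functional of [W'] composed with [F] vanishes on the
    ideal in degree [i]. The columns of the cokernel of [W] provide the elements of the ideal to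
    test. *)
Lemma quotmx_sub m i d n n' W W' (F : R) : F \is d.-homog ->
  @quotmx m i n W -> @quotmx m (i + d) n' W' -> (W' *m Cf m F <= W)%MS.
Proof.
move=> hF [leW _ WP] [leW' _ WP']; rewrite submxE; apply/eqP/matrixP => a b.
set Z := cokermx W; have WZ : W *m Z = 0 := mulmx_coker W.
have hp := dhomog_polyv_Hd i (col b Z); set p := polyv _ in hp.
have Ip : I p.
  apply/(WP _ hp); rewrite polyvK mulmxA (mul_Hd leW) mulmx_col WZ.
  by rewrite -[col _ _]/(col b 0) col0.
have /WP' : F * p \is (i + d).-homog by rewrite addnC; apply: dhomogM.
case=> /(_ (IM F Ip)) e _.
rewrite -Cf_cvec polyvK 2!mulmxA (mul_Hd (Cf_Hd hF leW')) mulmx_col in e.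
by have /colP/(_ a) := e; rewrite mxE => ->; rewrite !mxE.
Qed.

(** Rank [n] makes [W' *m Cf m F] span the same functionals as [W], which gives injectivity; rank
    [n'] provides a right inverse, which gives preimages. *)
Lemma quotmx_maxrank m i d n n' W W' (F : R) : F \is d.-homog ->
  @quotmx m i n W -> @quotmx m (i + d) n' W' ->
  (minn n n' <= \rank (W' *m Cf m F))%N -> maxrank I d F i.
Proof.
move=> hF qW qW'; have leQ := quotmx_sub hF qW qW'.
case: (qW) (qW') => [leW /eqP rW WP] [leW' rW' WP'].
set Q := W' *m Cf m F in leQ *.
have QH : Q *m Hd m i = Q by apply: mul_Hd; apply: Cf_Hd leW'.
rewrite geq_min => /orP[ge_n|ge_n'].
  left=> g hg IFg; apply/(WP _ hg).
  have /submxP[Y ->] : (W <= Q)%MS.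
    by rewrite -(geq_leqif (mxrank_leqif_sup leQ)) rW.
  have hFg : F * g \is (i + d).-homog by rewrite addnC; apply: dhomogM.
  by rewrite -mulmxA -mulmxA Cf_cvec ((WP' _ hFg).1 IFg) mulmx0.
right=> q hq; have /row_freeP[B QB] : row_free Q.
  by rewrite /row_free eqn_leq rank_leq_row.
have hg := dhomog_polyv_Hd i (B *m (W' *m cvec m q)); set g := polyv _ in hg.
exists g; split=> //; have hFg : F * g \is (i + d).-homog by rewrite addnC; apply: dhomogM.
apply/WP'; first exact: rpredB.
have E (y : 'cV_n') : W' *m (Cf m F *m (Hd m i *m (B *m y))) = y.
  by rewrite mulmxA -/Q mulmxA QH mulmxA QB mul1mx.
by rewrite linearB /= mulmxBr -Cf_cvec polyvK E subrr.
Qed.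

Lemma hilb0_maxrank i d F : hilb I (i + d) 0 -> maxrank I d F i.
Proof.
case=> s [/size0nil-> _ _ span]; right=> q /span[c].
by rewrite big_ord0 subr0 => Iq; exists 0; rewrite mulr0 subr0; split; first exact: dhomog0.
Qed.

Lemma meval_line M (G : {mpoly k[M]}) (x y : 'I_M -> k) :
  exists f : {poly k}, forall s, f.[s] = meval (fun i => x i + s * (y i - x i)) G.
Proof.
exists (mmap polyC (fun i => (x i)%:P + 'X * (y i - x i)%:P) G) => s.
rewrite mevalE /mmap horner_sum; apply: eq_bigr => u _.
rewrite hornerM hornerC /mmap1 horner_prod; congr (_ * _); apply: eq_bigr => i _.
by rewrite horner_exp hornerD hornerM !hornerC hornerX.
Qed.

(** The polynomial is a determinant certifying rank [c] at [F0], written for [GC], the matrix of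
    multiplication by the form with indeterminate coefficients. *)
Lemma rank_general m d c n (W : 'M[k]_(n, #|{: 'X_{1..r < m.+1}}|)) (F0 : R) :
  F0 \is d.-homog -> (c <= \rank (W *m Cf m F0))%N ->
  exists2 G : {mpoly k[#|{: 'X_{1..r < d.+1}}|]}, meval (coefv d F0) G != 0 &
    forall F, F \is d.-homog -> meval (coefv d F) G != 0 ->
      (c <= \rank (W *m Cf m F))%N.
Proof.
move=> hF0 /mxrank_minor[L [B eq1]].
pose M := #|{: 'X_{1..r < d.+1}}|.
pose toC (a b : nat) (A : 'M[k]_(a, b)) := map_mx (@mpolyC M k) A.
pose GC : 'M[{mpoly k[M]}]_(_) := \matrix_(a, b)
  \sum_(x < M) (Cf m ('X_[mon x] : R)) a b *: ('X_x : {mpoly k[M]}).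
pose G := \det (toC _ _ L *m (toC _ _ W *m GC) *m toC _ _ B).
have GE F : F \is d.-homog ->
    meval (coefv d F) G = \det (L *m (W *m Cf m F) *m B).
  move=> hF; rewrite /G -det_map_mx !map_mxM.
  have toCK a b (A : 'M[k]_(a, b)) : map_mx (meval (coefv d F)) (toC _ _ A) = A.
    by apply/matrixP => x y; rewrite !mxE mevalC.
  rewrite !toCK; congr (\det (L *m (W *m _) *m B)).
  rewrite [in RHS](dhomog_cvec_eq hF (leqnn d)) linear_sum.
  apply/matrixP => a b; rewrite !mxE raddf_sum summxE; apply: eq_bigr => x _.
  by rewrite [in RHS]linearZ /= mevalZ mevalXU [RHS]mxE mulrC.
exists G; first by rewrite GE // eq1 det1 oner_eq0.
by move=> F hF; rewrite GE //; apply: mxrank_minorP.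
Qed.

End HilbertMatrix.

(** * A numerical criterion for the Maximal Rank Property *)

Section MRPCriterion.
Variables (k : fieldType) (rho : nat).
Hypothesis k_char0 : [pchar k] =i pred0.
Local Notation R := {mpoly k[rho.+1]}.
Variable I : R -> Prop.
Variable h : nat -> nat.
Hypothesis I_ideal : homog_ideal I.
Hypothesis I_hilb : forall d, hilb I d (h d).

Lemma hilb_leq_bin d : (h d <= 'C(rho + d, d))%N.
Proof.
have [W [leW /eqP rW _]] := hilb_quotmx I_ideal (leqnn d) (I_hilb d).
by rewrite -[X in (X <= _)%N]rW; exact: rank_Hd_le leW.
Qed.

Lemma macaulay d : (lexD rho d.+1 (h d.+1) <= h d)%N.
Proof.
have [W qW] := hilb_quotmx I_ideal (leqnSn d) (I_hilb d).
have [W' qW'] := hilb_quotmx I_ideal (leqnn d.+1) (I_hilb d.+1).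
have [leW' /eqP rW' _] := qW'; have [_ /eqP rW _] := qW.
have [l hl] := green_mpoly k_char0 leW'; rewrite rW' => /leq_trans; apply.
rewrite -[X in (_ <= X)%N]rW; apply: mxrankS; apply: (quotmx_sub I_ideal hl qW).
by rewrite [(d + 1)%N]addn1.
Qed.

Lemma hilb_maxrank_general d i :
  (minn (h i) (h (i + d)) <= lexDiter rho i d (h (i + d)))%N ->
  exists2 G : {mpoly k[#|{: 'X_{1..rho.+1 < d.+1}}|]},
    (exists2 F : R, F \is d.-homog & meval (coefv d F) G != 0) &
    forall F, F \is d.-homog -> meval (coefv d F) G != 0 -> maxrank I d F i.
Proof.
have [W qW] := hilb_quotmx I_ideal (leq_addr d i) (I_hilb i).
have [W' qW'] := hilb_quotmx I_ideal (leqnn (i + d)) (I_hilb (i + d)).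
move=> ge_min; have [leW' /eqP rW' _] := qW'.
have [F hF] := green_iter k_char0 leW'; rewrite rW' => /(leq_trans ge_min).
case/(rank_general hF)=> G G_F GP; exists G; first by exists F.
by move=> F' hF' /(GP _ hF'); apply: (quotmx_maxrank I_ideal hF' qW qW').
Qed.

Lemma hilb_MRP e :
  (forall j, (e < j)%N -> h j = 0%N) ->
  (forall d i, (0 < d)%N -> (i + d <= e)%N ->
     minn (h i) (h (i + d)) <= lexDiter rho i d (h (i + d)))%N ->
  MRP I.
Proof.
move=> h0 ge_min d d_gt0.
have [G [F0 hF0 G_F0] GP] : exists2 G : {mpoly k[#|{: 'X_{1..rho.+1 < d.+1}}|]},
    (exists2 F : R, F \is d.-homog & meval (coefv d F) G != 0) &
    forall F, F \is d.-homog -> meval (coefv d F) G != 0 ->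
      forall i, (i < e)%N -> maxrank I d F i.
  elim: (e) => [|n [G [F hF G_F] GP]].
    by exists 1; [exists 0; [exact: dhomog0|rewrite meval1 oner_eq0]|].
  have [G' [F' hF' G_F'] GP'] : exists2 G : {mpoly k[#|{: 'X_{1..rho.+1 < d.+1}}|]},
      (exists2 F : R, F \is d.-homog & meval (coefv d F) G != 0) &
      forall F, F \is d.-homog -> meval (coefv d F) G != 0 -> maxrank I d F n.
    have [le_nd|gt_nd] := leqP (n + d) e.
      by apply: hilb_maxrank_general; apply: ge_min.
    exists 1; first by exists 0; [exact: dhomog0|rewrite meval1 oner_eq0].
    by move=> *; apply: hilb0_maxrank; rewrite -(h0 _ gt_nd).
  (* Two nonempty open sets of forms meet: on the line through a point of each, both polynomials
     restrict to nonzero polynomials in one parameter. *)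
  have [f fP] := meval_line G (coefv d F) (coefv d F').
  have [f' fP'] := meval_line G' (coefv d F) (coefv d F').
  have f_neq0 : f != 0.
    apply: contraNneq G_F => f0; have := fP 0; rewrite f0 horner0 => ->.
    by apply/eqP/meval_eq => x; rewrite mul0r addr0.
  have f'_neq0 : f' != 0.
    apply: contraNneq G_F' => f0; have := fP' 1; rewrite f0 horner0 => ->.
    by apply/eqP/meval_eq => x; rewrite mul1r addrC subrK.
  have [s] : exists s, (f * f').[s] != 0 by apply: poly_nonroot; rewrite // mulf_neq0.
  rewrite hornerM mulf_eq0 negb_or fP fP' => /andP[nz nz'].
  pose Fs := F + s *: (F' - F).
  have hFs : Fs \is d.-homog by rewrite rpredD // rpredZ // rpredB.
  have EFs : coefv d Fs =1 fun x => coefv d F x + s * (coefv d F' x - coefv d F x).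
    by move=> x; rewrite /coefv /Fs mcoeffD mcoeffZ mcoeffB.
  exists (G * G'); first exists Fs => //.
    by rewrite mevalM !(meval_eq _ EFs) mulf_neq0.
  move=> F1 hF1; rewrite mevalM mulf_eq0 negb_or => /andP[nz1 nz1'] i.
  rewrite ltnS leq_eqVlt => /orP[/eqP->|lt_in]; first exact: GP'.
  exact: GP.
exists (fun G' => G' = G); split; first by exists F0; split=> //; exists G.
move=> F hF [_ [-> nz]] i; have [lt_ie|ge_ie] := ltnP i e; first exact: GP.
by apply: hilb0_maxrank; rewrite -(h0 (i + d)%N) //; lia.
Qed.

End MRPCriterion.


(** * Numerical consequences of Green's and Macaulay's bounds *)

Lemma leq_minn_lexDiter rho i d c : (0 < rho)%N ->
  (minn c i.+1 <= lexDiter rho i d c)%N.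
Proof.
move=> rho_gt0; elim: d c => [|d IHd] c /=; first exact: geq_minl.
apply: leq_trans (IHd _).
have : (lexD rho (i + d.+1) (minn c (i + d.+1)) <= lexD rho (i + d.+1) c)%N.
  by apply: leq_lexD; rewrite geq_minl.
by rewrite lexD_diag //; lia.
Qed.

Lemma lexDiter_eq rho (h : nat -> nat) i d :
  (forall j, (i <= j < i + d)%N -> lexD rho j.+1 (h j.+1) = h j) ->
  lexDiter rho i d (h (i + d)%N) = h i.
Proof.
elim: d => [|d IHd] hE /=; first by rewrite addn0.
rewrite addnS hE; last by lia.
by apply: IHd => j lt_j; apply: hE; lia.
Qed.

Section MacaulayTail.
Variables (rho : nat) (h : nat -> nat).
Hypothesis rho_gt0 : (0 < rho)%N.
Hypothesis h_mac : forall d, (lexD rho d.+1 (h d.+1) <= h d)%N.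

Lemma macaulay_eq0 e j : h e = 0%N -> (e <= j)%N -> h j = 0%N.
Proof.
move=> he /subnKC <-; elim: (j - e)%N => [|n IHn]; first by rewrite addn0.
apply/eqP; rewrite addnS -leqn0 leqNgt; apply/negP => /(lexD_gt0 rho (e + n)).
by have := h_mac (e + n); lia.
Qed.

(** Up to the degree, [lexD] is the identity, so Macaulay's bound forbids growth; a value above its
    degree would force the preceding value above [t]. *)
Lemma macaulay_tail t j : (h t <= t)%N -> (t <= j)%N -> (h j <= h t)%N.
Proof.
move=> ht /subnKC <-; elim: (j - t)%N => [|n IHn]; first by rewrite addn0.
rewrite addnS; have := h_mac (t + n).
have [le_h|lt_h] := leqP (h (t + n).+1) (t + n).+1.
  by rewrite lexD_diag //; lia.
have := leq_lexD rho (t + n).+1 (ltnW lt_h); rewrite lexD_diag //; lia.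
Qed.

End MacaulayTail.

(** It suffices to treat the last variable, which gives the smallest product, and there
    [lexD_lexpos] locates the position. *)
Lemma lexpos_incr_nth rho s i c : size s = rho.+1 -> (i < size s)%N ->
  (lexD rho (sumn s).+1 c <= lexpos s)%N -> (c <= lexpos (incr_nth s i))%N.
Proof.
move=> size_s lt_i le_c; apply: leq_trans (lexpos_incr_last lt_i).
have [_ e2] := lexD_lexpos size_s; rewrite leqNgt; apply/negP => /(leq_lexD rho (sumn s).+1).
by rewrite e2 ltnNge le_c.
Qed.

Lemma lexpos_large s : (1 < size s)%N -> (sumn s < lexpos s)%N ->
  exists2 i, (i.+2 < size s)%N & nth 0%N s i != 0%N.
Proof.
move=> size_s lt_s; have Hs := cat_take_drop (size s - 2) s.
have [/allP z|/allPn[x x_s x0]] := boolP (all (eq_op 0) (take (size s - 2) s)).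
  case: (drop _ s) Hs (size_drop (size s - 2) s) => [|b [|a [|]]] Hs /=; try lia.
  move=> _; move: lt_s; rewrite -Hs lexpos_last2 ?sumn_cat /=; first by lia.
  by move=> x /z/eqP.
exists (index x (take (size s - 2) s)).
  by move: x_s; rewrite -index_mem size_take; case: ifP; lia.
move: (x_s); rewrite -index_mem size_take => lt_x.
rewrite -(@nth_take (size s - 2)); last by move: lt_x; case: ifP; lia.
by rewrite nth_index // eq_sym.
Qed.

Lemma mnm_seq_addU n (u : 'X_{1..n}) (i : 'I_n) : (u + U_(i))%MM = incr_nth u i :> seq nat.
Proof.
apply: (@eq_from_nth _ 0%N); first by rewrite size_incr_nth !size_tuple ltn_ord.
move=> j; rewrite size_tuple => lt_j.
rewrite -(mnm_nth _ _ (Ordinal lt_j)) nth_incr_nth -(mnm_nth _ _ (Ordinal lt_j)).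
by rewrite mnmDE mnm1E addnC.
Qed.

Lemma sumn_mdeg n (u : 'X_{1..n}) : sumn u = mdeg u.
Proof. by rewrite /mdeg sumnE. Qed.

(** * Lexsegment ideals *)

Section LexIdeal.
Variables (k : fieldType) (rho : nat) (h : nat -> nat).
Hypothesis h_bin : forall d, (h d <= 'C(rho + d, d))%N.
Hypothesis h_mac : forall d, (lexD rho d.+1 (h d.+1) <= h d)%N.
Local Notation R := {mpoly k[rho.+1]}.
Implicit Types (u w : 'X_{1..rho.+1}) (p q : R).

Definition lexmon u : bool := (h (mdeg u) <= lexpos u)%N.
Definition lexideal p : Prop := forall u, u \in msupp p -> lexmon u.

(** By [h_mac] the hypothesis is weaker than [lexmon u]; it thus also exhibits socle elements
    outside the ideal, as [lex_not_inj] needs. *)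
Lemma lexmonU u i : (lexD rho (mdeg u).+1 (h (mdeg u).+1) <= lexpos u)%N -> lexmon (u + U_(i)).
Proof.
move=> le_u; rewrite /lexmon mnm_seq_addU mdegD mdeg1 addn1.
by apply: (@lexpos_incr_nth rho); rewrite ?size_tuple ?sumn_mdeg.
Qed.

Lemma lexmonD u w : lexmon u -> lexmon (u + w).
Proof.
have [n] := ubnP (mdeg w); elim: n w => // n IHn w lt_n lex_u.
have [->|w_neq0] := eqVneq w 0%MM; first by rewrite addm0.
have [i wi] : exists i, w i != 0%N.
  apply/existsP; apply: contraNT w_neq0 => /existsPn w0.
  by apply/eqP/mnmP => i; rewrite mnm0E; apply/eqP; have := w0 i; rewrite negbK.
have le_i : (U_(i) <= w)%MM by rewrite lep1mP.
rewrite -(submK le_i) addmA; apply: lexmonU; apply: leq_trans (h_mac _) _.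
apply: IHn lex_u; move: lt_n; rewrite -{1}(submK le_i) mdegD mdeg1; lia.
Qed.

Lemma lexideal_homog : homog_ideal lexideal.
Proof.
split.
- by move=> u; rewrite msupp0.
- move=> p q Ip Iq u /msuppD_le; rewrite mem_cat => /orP[]; [exact: Ip|exact: Iq].
- move=> p q Iq u /msuppM_le/allpairsP[[u1 u2] /= [_ u2q ->]].
  by rewrite addmC; apply/lexmonD/Iq.
move=> d p Ip u u_hp; apply: Ip; apply: contraTT u_hp => uNp.
rewrite -mcoeff_eq0 /hcomp raddf_sum big1_seq // => w /andP[_ w_p] /=.
rewrite mcoeffZ mcoeffX; case: eqP => [e|]; rewrite ?mulr0 //.
by rewrite -e w_p in uNp.
Qed.

Lemma mnm_lexpos_ex (d q : nat) : (q < 'C(rho + d, d))%N ->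
  exists2 u : 'X_{1..rho.+1}, mdeg u = d & lexpos u = q.
Proof.
case/lexpos_ex=> s [size_s sum_s Eq]; have /eqP size_s' := size_s.
exists [multinom Tuple size_s']; last by rewrite -Eq.
by rewrite -sumn_mdeg.
Qed.

Lemma mnm_lexpos_inj u w : mdeg u = mdeg w -> lexpos u = lexpos w -> u = w.
Proof.
move=> deg_u eq_u; apply/val_inj/val_inj/lexpos_inj; rewrite ?size_tuple //.
by rewrite !sumn_mdeg.
Qed.

Lemma lexideal_hilb d : hilb lexideal d (h d).
Proof.
have [ms [size_ms msP]] : exists ms : seq 'X_{1..rho.+1}, size ms = h d /\
    forall q : nat, (q < h d)%N -> mdeg (nth 0%MM ms q) = d /\ lexpos (nth 0%MM ms q) = q.
  elim: (h d) (h_bin d) => [|n IHn] le_n; first by exists [::].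
  have [|ms [size_ms msP]] := IHn; first exact: ltnW.
  have [u deg_u pos_u] := mnm_lexpos_ex le_n.
  exists (rcons ms u); rewrite size_rcons size_ms; split=> // q.
  rewrite ltnS leq_eqVlt nth_rcons size_ms => /orP[/eqP->|lt_q].
    by rewrite ltnn eqxx.
  by rewrite lt_q; apply: msP.
pose s : seq R := [seq 'X_[u] | u <- ms].
have sE (i : 'I_(size s)) : s`_i = 'X_[nth 0%MM ms i].
  by rewrite (nth_map 0%MM) // -(size_map (fun u => 'X_[u] : R) ms).
have lt_i (i : 'I_(size s)) : (i < h d)%N.
  by rewrite -size_ms -(size_map (fun u => 'X_[u] : R) ms).
have coefE (c : 'I_(size s) -> k) (i : 'I_(size s)) : (\sum_j c j *: s`_j)@_(nth 0%MM ms i) = c i.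
  rewrite raddf_sum (bigD1 i) //= sE mcoeffZ mcoeffX eqxx mulr1 big1 ?addr0 // => j ne_j.
  rewrite sE mcoeffZ mcoeffX; case: eqP => [e|]; rewrite ?mulr0 //.
  case/eqP: ne_j; apply/val_inj => /=.
  by rewrite -(msP _ (lt_i j)).2 e (msP _ (lt_i i)).2.
exists s; split.
- by rewrite size_map.
- apply/allP => _ /mapP[u /(nthP 0%MM)[q lt_q <-] ->]; rewrite dhomogX.
  by apply/eqP; apply: (msP _ _).1; rewrite -size_ms.
- move=> c Ic i; apply/eqP; apply: contraT => ci; have := Ic (nth 0%MM ms i).
  rewrite mcoeff_msupp coefE => /(_ ci); rewrite /lexmon.
  by have [-> ->] := msP _ (lt_i i); rewrite leqNgt lt_i.
move=> p hp; exists (fun i => p@_(nth 0%MM ms i)) => u; rewrite mcoeff_msupp.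
apply: contraR => lex_u; rewrite mcoeffB.
have [deg_u|ne_u] := eqVneq (mdeg u) d; last first.
  rewrite (dhomog_nemf_coeff hp ne_u) sub0r oppr_eq0 raddf_sum big1 // => j _ /=.
  rewrite sE mcoeffZ mcoeffX; case: eqP => [e|]; rewrite ?mulr0 //.
  by case/eqP: ne_u; rewrite -e; apply: (msP _ _).1.
have lt_u : (lexpos u < h d)%N by move: lex_u; rewrite /lexmon deg_u -ltnNge.
have lt_u' : (lexpos u < size s)%N by rewrite size_map size_ms.
have Eu : u = nth 0%MM ms (Ordinal lt_u').
  have [e1 e2] := msP _ lt_u; apply: mnm_lexpos_inj; first by rewrite e1.
  by rewrite e2.
by rewrite {2}Eu coefE -Eu subrr.
Qed.

Lemma lin_expand (F : R) : F \is 1.-homog -> F = \sum_i F@_U_(i) *: 'X_i.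
Proof.
move=> hF; apply/mpolyP => u; rewrite raddf_sum /=.
under eq_bigr do rewrite mcoeffZ mcoeffX.
have [/eqP/mdeg1P[i /eqP->]|ne_u] := eqVneq (mdeg u) 1%N.
  rewrite (bigD1 i) //= eqxx mulr1 big1 ?addr0 // => j ne_j.
  by rewrite eq_mnm1 (negbTE ne_j) mulr0.
rewrite (dhomog_nemf_coeff hF ne_u) big1 // => i _; case: eqP => [e|]; rewrite ?mulr0 //.
by rewrite -e /= mdeg1 in ne_u.
Qed.

Lemma MRP_ex (I : R -> Prop) d : MRP I -> (0 < d)%N ->
  exists2 F : R, F \is d.-homog & forall i, maxrank I d F i.
Proof.
move=> mrp d_gt0; have [S [[F [hF SF]] SP]] := mrp d d_gt0.
by exists F => //; apply: SP.
Qed.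

Lemma mcoeff_mulXi (F : R) i u : u i = 0%N -> (F * 'X_i)@_u = 0.
Proof.
move=> ui; apply: memN_msupp_eq0; apply/negP => /msuppM_le/allpairsP[[u1 u2] /= [_]].
rewrite msuppX inE => /eqP-> Eu; move: ui; rewrite Eu mnmDE mnm1E eqxx; lia.
Qed.

End LexIdeal.

(** * Lexsegment algebras without the Maximal Rank Property *)

Section LexFailure.
Variables (k : fieldType) (rho : nat) (h : nat -> nat).
Local Notation n := rho.+2.
Hypothesis h_bin : forall d, (h d <= 'C(rho.+1 + d, d))%N.
Hypothesis h_mac : forall d, (lexD rho.+1 d.+1 (h d.+1) <= h d)%N.
Local Notation R := {mpoly k[n]}.
Local Notation J := (@lexideal k rho.+1 h).

Lemma lex_not_inj (F : R) j : F \is 1.-homog ->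
  (lexD rho.+1 j.+1 (h j.+1) < h j)%N ->
  ~ (forall g : R, g \is j.-homog -> J (F * g) -> J g).
Proof.
move=> hF lt_j inj.
have [u deg_u pos_u] := mnm_lexpos_ex (leq_trans lt_j (h_bin j)).
have /(_ u) : J 'X_[u].
  apply: inj; first by rewrite dhomogX; apply/eqP.
  move=> w /msuppM_le/allpairsP[[u1 u2] /= [u1F]].
  rewrite msuppX inE => /eqP-> ->.
  have /eqP/mdeg1P[i /eqP->] := dhomog_mf hF u1F.
  by rewrite addmC; apply: lexmonU; rewrite deg_u pos_u.
by rewrite msuppX mem_head /lexmon deg_u pos_u leqNgt lt_j => /(_ isT).
Qed.

(** In degree [j + 1] every monomial of [J] involves a variable before the last two, so [J] vanishes
    on the plane of the last two coordinates. Surjectivity would make all forms of that degree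
    vanish at a nonzero zero of [F] in this plane, which powers of variables do not. *)
Lemma lex_not_surj (F : R) j : F \is 1.-homog -> (j.+1 < h j.+1)%N ->
  ~ (forall q : R, q \is (j + 1)%N.-homog ->
       exists g : R, g \is j.-homog /\ J (q - F * g)).
Proof.
move=> hF lt_h surj.
pose a : 'I_n := ord_max; pose b : 'I_n := inord rho.
have Eb : b = rho :> nat by rewrite inordK.
have ne_ab : (b == a) = false by apply/eqP => /(congr1 val) /=; rewrite Eb; lia.
pose al := F@_U_(b); pose be := F@_U_(a).
have [va [vb [v0 nz]]] : exists va vb : k, al * vb + be * va = 0 /\ (va != 0) || (vb != 0).
  have [al0|al_neq0] := eqVneq al 0; last first.
    by exists al; exists (- be); rewrite al_neq0 mulrN mulrC addNr.
  have [be0|be_neq0] := eqVneq be 0.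
    by exists 1; exists 1; rewrite al0 be0 !mul0r addr0 oner_eq0.
  by exists 0; exists 1; rewrite al0 mul0r mulr0 addr0 oner_eq0 orbT.
pose v (x : 'I_n) := if x == a then va else if x == b then vb else 0.
have vF : meval v F = 0.
  rewrite (lin_expand hF) raddf_sum /= (bigD1 a) //= (bigD1 b) /= ?ne_ab //.
  rewrite !mevalZ !mevalXU /v !eqxx ne_ab -/al -/be addrA [_ + al * _]addrC v0 add0r.
  by rewrite big1 // => x /andP[/negbTE xa /negbTE xb]; rewrite mevalZ mevalXU xa xb mulr0.
have vq q : q \is (j + 1)%N.-homog -> meval v q = 0.
  move=> hq; have [g [hg Jq]] := surj q hq.
  have hd : q - F * g \is (j + 1)%N.-homog.
    by apply: rpredB => //; rewrite addnC; apply: dhomogM.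
  have : meval v (q - F * g) = 0.
    rewrite mevalE big1_seq // => u /andP[_ u_supp].
    have deg_u : mdeg u = j.+1 by rewrite (dhomog_mf hd u_supp) addn1.
    have [||i lt_i ui] := @lexpos_large u; first by rewrite size_tuple.
      have := Jq u u_supp; rewrite /lexmon sumn_mdeg deg_u; lia.
    rewrite size_tuple in lt_i; have lt_in : (i < n)%N by lia.
    rewrite (bigD1 (Ordinal lt_in)) //= (mnm_nth 0%N) /= {1}/v.
    case: eqP => [/(congr1 val)/=|_]; first by lia.
    case: eqP => [/(congr1 val)/=|_]; first by rewrite Eb; lia.
    by rewrite expr0n (negbTE ui) mul0r mulr0.
  by rewrite mevalB mevalM vF mul0r subr0.
have vx x : v x = 0.
  have hX : 'X_x \is [in k[n], 1.-homog] by rewrite dhomogX /= mdeg1.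
  have := dhomogMn (j + 1) hX; rewrite mul1n => /vq.
  by rewrite rmorphXn /= mevalXU => /eqP; rewrite expf_eq0 => /andP[_ /eqP].
have := vx a; have := vx b; rewrite /v !eqxx ne_ab => vb0 va0.
by move: nz; rewrite va0 vb0 eqxx.
Qed.

Lemma lex_WLP_fail j : (lexD rho.+1 j.+1 (h j.+1) < h j)%N ->
  (j.+1 < h j.+1)%N -> ~ MRP J.
Proof.
move=> lt_j lt_h /(MRP_ex)/(_ (isT : (0 < 1)%N))[F hF /(_ j)[|]].
  exact: lex_not_inj.
exact: lex_not_surj.
Qed.

(** As [h t <= t], the monomials outside [J] in degree [t] involve only the last two variables.
    Hence [F] kills the first variable, which is itself outside [J] because [h 1 = n]. *)
Lemma lex_MRP_fail t : (0 < rho)%N -> h 1%N = n -> (2 < h t)%N -> (h t <= t)%N -> ~ MRP J.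
Proof.
move=> rho_gt0 h1 ht3 htt mrp; have t_gt0 : (0 < t.-1)%N by lia.
have [F hF /(_ 1%N)] := MRP_ex mrp t_gt0.
have Et : (1 + t.-1)%N = t by lia.
rewrite /maxrank Et; case=> [inj|surj].
  have /(_ U_(ord0)%MM) : J 'X_ord0.
    apply: inj; first by rewrite dhomogX /= mdeg1.
    move=> u u_supp; rewrite /lexmon.
    have hFX : F * 'X_ord0 \is t.-homog.
      by rewrite -Et addnC; apply: dhomogM => //; rewrite dhomogX /= mdeg1.
    have deg_u : mdeg u = t := dhomog_mf hFX u_supp.
    rewrite deg_u leqNgt; apply/negP => lt_u.
    have ui : u ord0 = 0%N.
      rewrite (mnm_nth 0%N); apply: lexpos_small; last by rewrite size_tuple.
      by rewrite sumn_mdeg deg_u; lia.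
    by move: u_supp; rewrite mcoeff_msupp mcoeff_mulXi // eqxx.
  rewrite msuppX mem_head /lexmon /= mdeg1 h1 => /(_ isT).
  rewrite leqNgt -[X in (_ < X)%N]bin1 -[X in 'C(X, _)]addn1.
  have := @lexpos_lt rho.+1 U_(ord0 : 'I_n)%MM; rewrite size_tuple sumn_mdeg mdeg1.
  by move=> /(_ erefl) ->.
(* The three smallest monomials lie outside [J]. Preimages of them would factor the identity of size
   3 through the coefficients at the last two variables. *)
have [u uP] : exists u : 'I_3 -> 'X_{1..n}, forall q, mdeg (u q) = t /\ lexpos (u q) = q.
  apply: (@fin_all_exists _ _ (fun (q : 'I_3) (w : 'X_{1..n}) => mdeg w = t /\ lexpos w = q)) => q.
  have [|w deg_w pos_w] := @mnm_lexpos_ex rho.+1 t q; last by exists w.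
  by apply: leq_trans (h_bin t); apply: leq_trans ht3; apply: ltn_ord.
have [g gP] : exists g : 'I_3 -> R, forall q, g q \is 1.-homog /\ J ('X_[u q] - F * g q).
  apply: (@fin_all_exists _ _ (fun q g => g \is 1.-homog /\ J ('X_[u q] - F * g))) => q.
  by apply: surj; rewrite dhomogX /=; apply/eqP; apply: (uP q).1.
pose x (l : 'I_2) : 'I_n := inord (rho + l).
pose A : 'M[k]_(3, 2) := \matrix_(q, l) (F * 'X_(x l))@_(u q).
pose B : 'M[k]_(2, 3) := \matrix_(l, q) (g q)@_U_(x l).
have /mulmx1_min // : A *m B = 1%:M.
apply/matrixP => q q'; rewrite !mxE.
have -> : ((q == q')%:R : k) = (F * g q')@_(u q).
  have -> : ((q == q')%:R : k) = 'X_[u q']@_(u q).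
    rewrite mcoeffX; congr (_%:R); congr nat_of_bool.
    apply/eqP/eqP => [->//|e]; apply/val_inj => /=.
    by rewrite -(uP q).2 -(uP q').2 e.
  apply/eqP; rewrite -subr_eq0 -mcoeffB; apply: contraT; rewrite -mcoeff_msupp.
  move=> /((gP q').2); rewrite /lexmon (uP q).1 (uP q).2 leqNgt.
  by rewrite (leq_trans _ ht3) // ltn_ord.
rewrite [in RHS](lin_expand (gP q').1) mulr_sumr raddf_sum /=.
under [RHS]eq_bigr do rewrite -scalerAr mcoeffZ.
rewrite [RHS]big_ord_recr [X in _ = X + _]big_ord_recr /=.
rewrite [X in _ = X + _ + _]big1 ?add0r; last first.
  move=> l _; rewrite mcoeff_mulXi ?mulr0 // (mnm_nth 0%N).
  apply: lexpos_small; last by rewrite size_tuple /= !ltnS ltn_ord.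
  by rewrite (uP q).2 sumn_mdeg (uP q).1; have := ltn_ord q; lia.
rewrite big_ord_recr big_ord_recr big_ord0 /= add0r !mxE.
have -> : x (widen_ord (leqnSn 1) ord_max) = widen_ord (leqnSn rho.+1) ord_max.
  by apply/val_inj; rewrite /= inordK //= addn0.
have -> : x ord_max = ord_max by apply/val_inj; rewrite /= inordK //= addn1.
by rewrite [X in X + _]mulrC [X in _ + X]mulrC.
Qed.

End LexFailure.

(** * The characterization of the Hilbert functions *)

Theorem theorem3p1 (k : fieldType) (r : nat) (h : nat -> nat) (e t : nat) :
  [pchar k] =i pred0 ->
  (2 <= r)%N ->
  h 0%N = 1%N -> h 1%N = r -> h e.+1 = 0%N ->
  (* H is the Hilbert function of some standard graded algebra k[x_1..x_r]/I *)
  (exists I : {mpoly k[r]} -> Prop, homog_ideal I /\ forall d, hilb I d (h d)) ->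
  (* t is the smallest integer with h_t <= t *)
  (h t <= t)%N -> (forall i, (i < t)%N -> (i < h i)%N) ->
  ((forall I : {mpoly k[r]} -> Prop,
       homog_ideal I -> (forall d, hilb I d (h d)) -> MRP I)
   <->
   (r = 2%N \/
    [/\ (2 < r)%N, (h t <= 2)%N &
        forall i, (1 <= i <= t.-1)%N ->
          exists ns, dbinom_exp (h i) i ns /\ h i.-1 = binom_down i ns])).
Proof.
move=> k0; case: r => [|[|rho]] // _ h0 h1 he [I0 [I0_ideal I0_hilb]] ht t_min.
have h_mac := macaulay k0 I0_ideal I0_hilb.
have h_bin := hilb_leq_bin I0_ideal I0_hilb.
split=> [allMRP|cond I I_ideal I_hilb].
  case: (posnP rho) => [->|rho_gt0]; [by left|right].
  have mrp := allMRP _ (lexideal_homog k h_mac) (lexideal_hilb k h_bin).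
  split=> //.
    by rewrite leqNgt; apply/negP => ht3; apply: (lex_MRP_fail h_bin rho_gt0 h1 ht3 ht mrp).
  case=> [//|j] /= lt_j; have lt_h : (j.+1 < h j.+1)%N by apply: t_min; lia.
  have [|ns ns_exp] := @dbinom_exp_ex j.+1 (h j.+1) isT; first by lia.
  exists ns; split=> //; rewrite (binom_down_lexD ns_exp (h_bin _)).
  apply/eqP; rewrite eqn_leq h_mac andbT leqNgt; apply/negP => lt_D.
  exact: (lex_WLP_fail h_bin lt_D lt_h mrp).
apply: (hilb_MRP k0 I_ideal I_hilb (e := e)) => [j lt_j|d i d_gt0 _].
  exact: macaulay_eq0 h_mac _ _ he lt_j.
have ge_iter := @leq_minn_lexDiter rho.+1 i d (h (i + d)%N) isT.
case: cond => [[rho0]|[_ ht2 hdown]].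
  by have := h_bin i; rewrite {1}rho0 add1n binSn; lia.
have [lt_t|ge_t] := ltnP (i + d) t.
  rewrite lexDiter_eq ?geq_minl // => j lt_j.
  have [|ns [ns_exp ->]] := hdown j.+1; first by lia.
  by rewrite (binom_down_lexD ns_exp (h_bin _)).
have := macaulay_tail (ltn0Sn rho) h_mac ht ge_t.
(* For [i = 0] the bound [i + 1] equals [h 0]; for positive [i] it is at least 2, hence at least
   [h (i + d)]. *)
by case: i ge_iter {ge_t} => [|i]; rewrite ?h0; lia.
Qed.
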